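(* Let $L_7$ be the seven-element lattice with elements $0,1,j_1,j_2,m_1,m_2,k$ whose covering relations are exactly $0\prec j_1$, $0\prec j_2$, $0\prec k$, $j_1\prec m_2$, $j_2\prec m_1$, $j_2\prec m_2$, $m_1\prec 1$, $m_2\prec 1$, $k\prec 1$. Every finite lattice $L$ with at most seven elements, with the one possible exception of lattices isomorphic to $L_7$, is representable as the congruence lattice of a finite algebra; that is, if $|L|\le 7$ and $L\not\cong L_7$, then there is a finite algebra $\mathbf A$ with $\operatorname{Con}\mathbf A\cong L$.
   Context: An algebra $\mathbf A=\langle A,F\rangle$ is a nonempty set $A$ together with a set $F$ of finitary operations on $A$; it is finite if $A$ is finite. $\operatorname{Con}\mathbf A$ denotes the lattice (under inclusion) of all congruence relations of $\mathbf A$, i.e. equivalence relations on $A$ compatible with all operations in $F$. *)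

(* Defs.v *)
From HB Require Import structures.
From mathcomp Require Import all_boot all_order.
From mathcomp Require Import boolp.

Set Implicit Arguments.
Unset Strict Implicit.
Unset Printing Implicit Defensive.

Import Order.TTheory.
Local Open Scope order_scope.

(* [is_op f] states that [f] belongs to the set of basic operations, which may
   be empty, infinite, or contain nullary operations ([n = 0]). *)
Record finAlgebra := FinAlgebra {
  carrier :> finType;
  carrier_gt0 : (0 < #|carrier|)%N;
  is_op : forall n, (n.-tuple carrier -> carrier) -> Prop
}.

Section Congruences.
Variable A : finAlgebra.

Definition compatible (r : {set A * A}) : Prop :=
  forall n (f : n.-tuple A -> A), is_op f ->
  forall u v : n.-tuple A,
    (forall i, (tnth u i, tnth v i) \in r) -> (f u, f v) \in r.

Definition congruence (r : {set A * A}) : Prop :=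
  [/\ forall x, (x, x) \in r,
      forall x y, (x, y) \in r -> (y, x) \in r,
      forall x y z, (x, y) \in r -> (y, z) \in r -> (x, z) \in r
    & compatible r].

(* [congruence] is turned into a boolean classically, since [is_op] may hold of
   infinitely many operations. *)
Record Con := MkCon {
  con_rel :> {set A * A};
  con_relP : `[< congruence con_rel >]
}.

HB.instance Definition _ := [isSub for con_rel].
HB.instance Definition _ := [Finite of Con by <:].

Lemma ConP (r : Con) : congruence r.
Proof. exact/asboolP/con_relP. Qed.

Lemma congruence_bigcap (P : pred Con) :
  congruence (\bigcap_(t | P t) con_rel t).
Proof.
split=> [x|x y|x y z|n f Ff u v uv].
- by apply/bigcapP=> t _; have [rr _ _ _] := ConP t.
- move=> /bigcapP xy; apply/bigcapP=> t Pt.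
  by have [_ sy _ _] := ConP t; apply/sy/xy.
- move=> /bigcapP xy /bigcapP yz; apply/bigcapP=> t Pt.
  by have [_ _ tr _] := ConP t; apply: tr (xy t Pt) (yz t Pt).
- apply/bigcapP=> t Pt; have [_ _ _ cp] := ConP t.
  by apply: cp => // i; have /bigcapP/(_ t Pt) := uv i.
Qed.

Definition con_bigcap (P : pred Con) : Con :=
  MkCon (asboolT (congruence_bigcap P)).

Lemma congruence_setI (r s : Con) : congruence (con_rel r :&: con_rel s).
Proof.
have [r1 r2 r3 r4] := ConP r; have [s1 s2 s3 s4] := ConP s.
split=> [x|x y|x y z|n f Ff u v uv]; rewrite !inE ?r1 ?s1 //.
- by case/andP=> /r2-> /s2->.
- by case/andP=> rxy sxy /andP[ryz syz]; rewrite (r3 x y z) // (s3 x y z).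
- by rewrite r4 ?s4 // => i; move: (uv i); rewrite inE => /andP[].
Qed.

Definition con_meet (r s : Con) : Con := MkCon (asboolT (congruence_setI r s)).

Definition con_join (r s : Con) : Con :=
  con_bigcap [pred t : Con | con_rel r :|: con_rel s \subset con_rel t].

Definition con_le (r s : Con) := con_rel r \subset con_rel s.

Fact con_le_refl : reflexive con_le. Proof. by move=> r; apply: subxx. Qed.

Fact con_le_anti : antisymmetric con_le.
Proof. by move=> r s rs; apply/val_inj/eqP; rewrite eqEsubset. Qed.

Fact con_le_trans : transitive con_le.
Proof. by move=> s r t; apply: subset_trans. Qed.

Fact con_display : Order.disp_t. Proof. exact: Order.Disp tt tt. Qed.

HB.instance Definition _ :=
  Order.Le_isPOrder.Build con_display Con con_le_refl con_le_anti con_le_trans.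

Fact con_meetP (r s t : Con) : (r <= con_meet s t) = (r <= s) && (r <= t).
Proof. exact: subsetI. Qed.

Fact con_joinP (r s t : Con) : (con_join r s <= t) = (r <= t) && (s <= t).
Proof.
rewrite -[RHS]subUset; apply/idP/idP => [|rst].
  by apply: subset_trans; apply/bigcapsP=> w.
exact: bigcap_inf.
Qed.

HB.instance Definition _ :=
  Order.POrder_MeetJoin_isLattice.Build con_display Con con_meetP con_joinP.

End Congruences.

Variant L7 := L7_0 | L7_1 | L7_j1 | L7_j2 | L7_m1 | L7_m2 | L7_k.

Definition L7_code (x : L7) : nat :=
  match x with
  | L7_0 => 0 | L7_1 => 1 | L7_j1 => 2 | L7_j2 => 3
  | L7_m1 => 4 | L7_m2 => 5 | L7_k => 6
  end.

Definition L7_seq := [:: L7_0; L7_1; L7_j1; L7_j2; L7_m1; L7_m2; L7_k].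

Fact L7_codeK : pcancel L7_code (onth L7_seq). Proof. by case. Qed.

HB.instance Definition _ := Countable.copy L7 (pcan_type L7_codeK).

Fact L7_enumP : Finite.axiom L7_seq. Proof. by case. Qed.

HB.instance Definition _ := isFinite.Build L7 L7_enumP.

Definition L7_cover (x y : L7) : bool :=
  match x, y with
  | L7_0, L7_j1 | L7_0, L7_j2 | L7_0, L7_k
  | L7_j1, L7_m2 | L7_j2, L7_m1 | L7_j2, L7_m2
  | L7_m1, L7_1 | L7_m2, L7_1 | L7_k, L7_1 => true
  | _, _ => false
  end.

(* The reflexive-transitive closure of [L7_cover]: a chain of two or more covers
   starts at [L7_0] or ends at [L7_1]. *)
Definition L7_le (x y : L7) : bool :=
  [|| x == y, x == L7_0, y == L7_1 | L7_cover x y].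

Definition L7_meet (x y : L7) : L7 :=
  if L7_le x y then x else if L7_le y x then y else
  match x, y with L7_m1, L7_m2 | L7_m2, L7_m1 => L7_j2 | _, _ => L7_0 end.

Definition L7_join (x y : L7) : L7 :=
  if L7_le x y then y else if L7_le y x then x else
  match x, y with L7_j1, L7_j2 | L7_j2, L7_j1 => L7_m2 | _, _ => L7_1 end.

Fact L7_le_refl : reflexive L7_le. Proof. by case. Qed.
Fact L7_le_anti : antisymmetric L7_le. Proof. by do 2!case. Qed.
Fact L7_le_trans : transitive L7_le. Proof. by do 3!case. Qed.

Fact L7_display : Order.disp_t. Proof. exact: Order.Disp tt tt. Qed.

HB.instance Definition _ :=
  Order.Le_isPOrder.Build L7_display L7 L7_le_refl L7_le_anti L7_le_trans.

Fact L7_meetP (x y z : L7) :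
  L7_le x (L7_meet y z) = L7_le x y && L7_le x z.
Proof. by case: x y z; do 2!case. Qed.

Fact L7_joinP (x y z : L7) :
  L7_le (L7_join x y) z = L7_le x z && L7_le y z.
Proof. by case: x y z; do 2!case. Qed.

HB.instance Definition _ :=
  Order.POrder_MeetJoin_isLattice.Build L7_display L7 L7_meetP L7_joinP.

Lemma L7_coverP (x y : L7) :
  reflect (x < y /\ forall z, ~~ (x < z < y)) (L7_cover x y).
Proof.
apply: (iffP idP) => [|[]].
  by case: x y; case=> // _; split=> //; case.
case: x y; case=> // _ H;
  by move: (H L7_j1) (H L7_j2) (H L7_m1) (H L7_m2).
Qed.

Definition lattice_isomorphic d (L : latticeType d) d' (M : latticeType d') :
  Prop := exists f : {lmorphism L -> M}, bijective f.

(* Main.v *)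
(* Each lattice [L] other than [L7] is the congruence lattice of an explicit finite
   unary algebra.  That an algebra represents [L] is a finite computation: the
   congruence generated by a pair of points is obtained by closing under the
   operations and merging classes, and a family of congruences that contains the
   congruence generated by each pair and is closed under joins is the whole congruence
   lattice.  That no lattice is missing is a finite computation too: along a linear
   extension, a lattice with [n] elements is an upper triangular 0-1 matrix with full
   first row and last column, which for [n <= 7] leaves at most [2 ^ 10] candidates. *)

From HB Require Import structures.
Require Import Defs.
From mathcomp Require Import all_boot all_order.
From mathcomp Require Import boolp zify.

Set Implicit Arguments.
Unset Strict Implicit.
Unset Printing Implicit Defensive.

Import Order.TTheory.

(** * Congruence closure *)

(** The closure is trusted for one inclusion only: its result lies in every congruence that contains
    the seeds. That the result is itself a congruence is tested on the computed labels, so any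
    amount of fuel is sound. Completeness of a list of congruences then follows by climbing: a
    congruence that properly contains a listed one also contains a listed one of larger index.

    The classification runs no isomorphism test. All relabelings of the known tables that keep both
    bounds in place are written out, and a candidate matrix has to occur among them literally. [L7]
    takes part in this comparison with tables of its own, without an algebra. The exponent 10 is the
    number of pairs among the five elements of a seven-element lattice other than the bounds. *)

(* An equivalence relation on [0, ..., m] is encoded by a list [p] of labels:
   [x] and [y] are equivalent when they carry the same label.  A unary operation
   is encoded by the list of its values. *)
Definition same (p : seq nat) : rel nat := fun x y => nth 0 p x == nth 0 p y.

(** A worklist algorithm. A merge gives the class of [x] the label of [y], so labels remain elements
    of their classes, and pushes the images of the merged pair under the operations. Running out of
    fuel returns the labels reached so far, a relation that is at worst too small. *)
Fixpoint closure (fuel : nat) (fs : seq (seq nat)) (p : seq nat)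
    (w : seq (nat * nat)) : seq nat :=
  match fuel, w with
  | k.+1, (x, y) :: w' =>
      let a := nth 0 p x in let b := nth 0 p y in
      if a == b then closure k fs p w'
      else closure k fs [seq if z == a then b else z | z <- p]
             ([seq (nth 0 f x, nth 0 f y) | f <- fs] ++ w')
  | _, _ => p
  end.

(* A label is meant to be an element of its own class; under this condition the
   test below decides the inclusion of [p] in [q]. *)
Definition finer (m : nat) (p q : seq nat) : bool :=
  all (fun z => same q z (nth 0 p z)) (iota 0 m.+1).

(** * The closure stays inside every congruence that contains its seeds *)

Section Soundness.
Variables (m : nat) (fs : seq (seq nat)) (R : rel nat).
Hypotheses (Rsym : symmetric R) (Rtr : transitive R).
Hypothesis fs_le : forall f x, f \in fs -> nth 0 f x <= m.
Hypothesis Rfs : forall f x y, f \in fs -> x <= m -> y <= m ->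
  R x y -> R (nth 0 f x) (nth 0 f y).

Definition within (p : seq nat) : Prop :=
  forall x y, x <= m -> y <= m -> same p x y -> R x y.

(** Invariant: the current classes and all pending pairs lie in [R]. When two classes merge, [R x y]
    links a point of one to a point of the other, and compatibility of [R] covers the pairs
    pushed. *)
Lemma closure_within k p w :
  size p = m.+1 -> within p ->
  (forall u, u \in w -> [/\ u.1 <= m, u.2 <= m & R u.1 u.2]) ->
  within (closure k fs p w).
Proof.
elim: k p w => [|k IHk] p [|[x y] w] //= szp Rp Rw.
have [lex ley Rxy] : [/\ x <= m, y <= m & R x y].
  by have := Rw (x, y); rewrite mem_head => /(_ isT).
have Rw' u : u \in w -> [/\ u.1 <= m, u.2 <= m & R u.1 u.2].
  by move=> wu; apply: Rw; rewrite inE wu orbT.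
case: eqP => [_|ab]; first exact: IHk.
apply: IHk => [||u]; first by rewrite size_map.
- move=> z t lez let_; rewrite /same !(nth_map 0) ?szp ?ltnS //.
  have xP s : s <= m -> nth 0 p s = nth 0 p x -> R s x.
    by move=> les e; apply: Rp => //; apply/eqP.
  have yP s : s <= m -> nth 0 p s = nth 0 p y -> R s y.
    by move=> les e; apply: Rp => //; apply/eqP.
  case: (nth 0 p z =P nth 0 p x) => [zx|_]; case: (nth 0 p t =P nth 0 p x) => [tx|_].
  + by move=> _; apply: Rtr (xP _ lez zx) _; rewrite Rsym xP.
  + move/eqP=> ty; apply: Rtr (xP _ lez zx) _; apply: Rtr Rxy _.
    by rewrite Rsym yP.
  + move/eqP=> zy; apply: Rtr (yP _ lez zy) _; rewrite Rsym.
    by apply: Rtr Rxy; apply: xP.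
  + exact: Rp.
- rewrite mem_cat => /orP[/mapP[f ffs ->] /=|]; last exact: Rw'.
  by split; [exact: fs_le | exact: fs_le | exact: Rfs].
Qed.

(** Two points with a common [p]-label are each related to that label through [q], hence through
    [R]. *)
Lemma finer_within p q :
  (forall z, z <= m -> nth 0 p z <= m) ->
  finer m p q -> within q -> within p.
Proof.
move=> p_le /allP pq Rq x y lex ley /eqP pxy.
have Rp z : z <= m -> R z (nth 0 p z).
  by move=> lez; apply: Rq; rewrite ?p_le ?pq // mem_iota.
by apply: Rtr (Rp x lex) _; rewrite Rsym pxy Rp.
Qed.

End Soundness.

(** * Unary representations *)

(* The algebra has the points [0, ..., top_point].  The congruences are listed
   by generating pairs, along a linear extension of their inclusion order. *)
Record unary_rep := UnaryRep {
  top_point : nat;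
  ops : seq (seq nat);
  gens : seq (seq (nat * nat))
}.

Section Representation.
Variable E : unary_rep.
Let m := top_point E.
Let fs := ops E.

(* Each of the at most [m] merges pushes [size fs] pairs. *)
Definition generated (p : seq nat) (w : seq (nat * nat)) : seq nat :=
  closure (m.+1 * (size fs).+1 + size w) fs p w.

Definition congs : seq (seq nat) := [seq generated (iota 0 m.+1) w | w <- gens E].

(** The nonempty default of [head] rejects an empty list. The first listed congruence has no
    generating pair and is therefore equality. *)
Definition well_formed : bool :=
  [&& all (all (fun v => v <= m)) fs,
      all (all (fun u => (u.1 <= m) && (u.2 <= m))) (gens E)
    & head [:: (0, 0)] (gens E) == [::]].

(** Points are compared with their labels only, which keeps the test linear in the number of
    points. *)
Definition cong_ok (w : seq (nat * nat)) (p : seq nat) : bool :=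
  [&& all (fun z => (nth 0 p z <= m) && same p z (nth 0 p z)) (iota 0 m.+1),
      all (fun f => all (fun z => same p (nth 0 f z) (nth 0 f (nth 0 p z)))
                        (iota 0 m.+1)) fs
    & all (fun u => same p u.1 u.2) w].

(** In a complete list along a linear extension, the first congruence containing a pair is the one
    generated by it. A result equal to [size ps] means that there is none. *)
Definition cong_of (ps : seq (seq nat)) (x y : nat) : nat :=
  find (fun p => same p x y) ps.

(* For [y < x], the congruence generated by [(x, y)] is computed only if no
   operation sends [(x, y)] to a smaller pair lying in the same congruences. *)
Definition pair_ok (ps : seq (seq nat)) (x y : nat) : bool :=
  let i := cong_of ps x y in
  if i < size ps then
    if has (fun f => let a := nth 0 f x in let b := nth 0 f y in
              let c := maxn a b in let d := minn a b in
              if (d < c) && ((c < x) || ((c == x) && (d < y)))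
              then cong_of ps c d == i else false) fs
    then true
    else finer m (nth [::] ps i) (generated (iota 0 m.+1) [:: (x, y)])
  else false.

(** Only some listed relation of index above [i] inside the join is asked for; this is what drives
    the climb in [cong_within]. *)
Definition join_ok (ps : seq (seq nat)) (i j : nat) : bool :=
  let p := nth [::] ps i in
  if finer m (nth [::] ps j) p then true
  else let q := generated p (nth [::] (gens E) j) in
       has (fun k => finer m (nth [::] ps k) q) (iota i.+1 (size ps - i.+1)).

Definition check_rep : bool :=
  let ps := congs in
  [&& well_formed,
      all (fun i => cong_ok (nth [::] (gens E) i) (nth [::] ps i))
          (iota 0 (size (gens E))),
      all (fun p => size p == m.+1) ps,
      all (fun x => all (pair_ok ps x) (iota 0 x)) (iota 0 m.+1)
    & all (fun i => all (join_ok ps i) (iota 0 (size ps))) (iota 0 (size ps))].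

Lemma card_ordS_gt0 : 0 < #|'I_m.+1|.
Proof. by rewrite card_ord. Qed.

(** An operation has any positive arity and reads a single coordinate [i], which avoids a cast along
    [n = 1]. The dummy arguments leave the congruences unchanged. *)
Definition rep_algebra : finAlgebra :=
  @FinAlgebra 'I_m.+1 card_ordS_gt0
    (fun n F => exists g i, g \in fs /\
       forall u : n.-tuple 'I_m.+1, F u = inord (nth 0 g (tnth u i))).

Definition label_set (p : seq nat) : {set rep_algebra * rep_algebra} :=
  [set u : 'I_m.+1 * 'I_m.+1 | same p u.1 u.2].

Hypothesis E_ok : check_rep.

(** * Listed relations are congruences *)

Lemma ops_le f x : f \in fs -> nth 0 f x <= m.
Proof.
case/and5P: E_ok => /and3P[/allP fsP _ _] _ _ _ _ /fsP/all_nthP fP.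
by have [lex|gex] := ltnP x (size f); [exact: fP | rewrite nth_default].
Qed.

Lemma gens_le w u : w \in gens E -> u \in w -> (u.1 <= m) && (u.2 <= m).
Proof. by case/and5P: E_ok => /and3P[_ /allP gP _] _ _ _ _ /gP/allP; apply. Qed.

Lemma size_congs : size congs = size (gens E). Proof. exact: size_map. Qed.

Lemma congs_ok i :
  i < size congs -> cong_ok (nth [::] (gens E) i) (nth [::] congs i).
Proof.
case/and5P: E_ok => _ /allP H _ _ _; rewrite size_congs => lti.
by apply: H; rewrite mem_iota.
Qed.

Lemma size_nth_congs i : i < size congs -> size (nth [::] congs i) = m.+1.
Proof. by case/and5P: E_ok => _ _ /all_nthP H _ _ /(H [::])/eqP. Qed.

Lemma pairs_ok x y : y < x -> x <= m -> pair_ok congs x y.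
Proof.
case/and5P: E_ok => _ _ _ /allP H _ ltyx lex.
have xs : x \in iota 0 m.+1 by rewrite mem_iota.
by have /allP := H _ xs; apply; rewrite mem_iota.
Qed.

Lemma joins_ok i j : i < size congs -> j < size congs -> join_ok congs i j.
Proof.
case/and5P: E_ok => _ _ _ _ /allP H lti ltj.
have is_ : i \in iota 0 (size congs) by rewrite mem_iota.
by have /allP := H _ is_; apply; rewrite mem_iota.
Qed.

Lemma cong_label i z : i < size congs -> z <= m ->
  nth 0 (nth [::] congs i) z <= m /\
  same (nth [::] congs i) z (nth 0 (nth [::] congs i) z).
Proof.
move=> /congs_ok/and3P[/allP H _ _] lez.
by apply/andP/H; rewrite mem_iota.
Qed.

(** Equivalent points share a label, and both images are equivalent to the image of that label. *)
Lemma cong_ops i f x y : i < size congs -> f \in fs -> x <= m -> y <= m ->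
  same (nth [::] congs i) x y ->
  same (nth [::] congs i) (nth 0 f x) (nth 0 f y).
Proof.
move=> /congs_ok/and3P[_ /allP H _] /H/allP{}H lex ley /eqP e.
have to_label z : z <= m -> nth 0 (nth [::] congs i) (nth 0 f z) =
    nth 0 (nth [::] congs i) (nth 0 f (nth 0 (nth [::] congs i) z)).
  by move=> lez; apply/eqP/H; rewrite mem_iota.
by apply/eqP; rewrite (to_label x) // (to_label y) // e.
Qed.

(** Left to right, both points of a pair move to their common label inside the larger relation.
    Conversely, the inclusion is applied to a point and its label, a pair of the smaller relation
    because labels belong to their classes. *)
Lemma finer_sub i j : i < size congs -> j < size congs ->
  finer m (nth [::] congs i) (nth [::] congs j) =
    (label_set (nth [::] congs i) \subset label_set (nth [::] congs j)).
Proof.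
move=> lti ltj; apply/allP/subsetP => [pq [x y] | pq z].
  rewrite !inE /= => /eqP e.
  have to_label (z : 'I_m.+1) : nth 0 (nth [::] congs j) z =
      nth 0 (nth [::] congs j) (nth 0 (nth [::] congs i) z).
    by apply/eqP/pq; rewrite mem_iota ltn_ord.
  by apply/eqP; rewrite (to_label x) (to_label y) e.
rewrite mem_iota add0n ltnS => /= lez.
have [lep pz] := cong_label lti lez.
have := pq (inord z, inord (nth 0 (nth [::] congs i) z)).
by rewrite !inE /= !inordK // => /(_ pz).
Qed.

Lemma label_congruence i :
  i < size congs -> congruence (label_set (nth [::] congs i)).
Proof.
move=> lti; split=> [x|x y|x y z|n F [g [k [gfs Fg]]] u v uv].
- by rewrite inE /same.
- by rewrite !inE /same eq_sym.
- by rewrite !inE /same => /eqP->.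
- rewrite !Fg inE /= !inordK ?ltnS ?ops_le //.
  by apply: cong_ops; rewrite ?leq_ord //; have := uv k; rewrite inE.
Qed.

(** * Every congruence is listed *)

Section Complete.
Variable r : Con rep_algebra.
Let R : rel nat := fun x y => ((inord x, inord y) : 'I_m.+1 * 'I_m.+1) \in con_rel r.

Let Rxx : reflexive R. Proof. by move=> x; case: (ConP r) => H _ _ _; apply: H. Qed.
Let Rsym : symmetric R.
Proof. by move=> x y; case: (ConP r) => _ H _ _; apply/idP/idP; apply: H. Qed.
Let Rtr : transitive R.
Proof. by move=> y x z; case: (ConP r) => _ _ H _; apply: H. Qed.

Let Rfs f x y : f \in fs -> x <= m -> y <= m -> R x y -> R (nth 0 f x) (nth 0 f y).
Proof.
move=> ffs lex ley Rxy; case: (ConP r) => _ _ _ cr.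
(* The instance of arity 1 turns compatibility into a statement about one pair. *)
pose F (u : 1.-tuple 'I_m.+1) : 'I_m.+1 := inord (nth 0 f (tnth u ord0)).
have := cr 1 F _ [tuple inord x] [tuple inord y].
rewrite /F !(tnth_nth ord0) /= !inordK //; apply; first by exists f, ord0.
by move=> i; rewrite ord1.
Qed.

Let Rcl := @closure_within m fs R Rsym Rtr ops_le Rfs.

Lemma iota_within : within m R (iota 0 m.+1).
Proof. by move=> x y lex ley; rewrite /same !nth_iota // !add0n => /eqP->. Qed.

(** Lexicographic induction on [(x, y)], following the test in [pair_ok]. If an operation lowers the
    pair and keeps [cong_of], the lowered pair is still in [R] and the induction hypothesis applies.
    Otherwise the listed relation was compared with the closure of the pair, which lies in [R]. *)
Lemma pair_within x y : x <= m -> y < x -> R x y ->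
  within m R (nth [::] congs (cong_of congs x y)).
Proof.
elim/ltn_ind: x y => x IHx y lex; elim/ltn_ind: y => y IHy ltyx Rxy.
have := pairs_ok ltyx lex; rewrite /pair_ok.
case: ifP => // lti; case: ifP => [/hasP[f ffs]|_ fin]; last first.
  have p_le z : z <= m -> nth 0 (nth [::] congs (cong_of congs x y)) z <= m.
    by move=> lez; have [] := cong_label lti lez.
  apply: (finer_within Rsym Rtr p_le fin); apply: Rcl.
  - by rewrite size_iota.
  - exact: iota_within.
  - by move=> u; rewrite inE => /eqP-> /=; rewrite lex (leq_trans (ltnW ltyx)).
set a := nth 0 f x; set b := nth 0 f y => dec _.
have Rab : R a b by apply: Rfs; rewrite // (leq_trans (ltnW ltyx)).
have Rcd : R (maxn a b) (minn a b) by rewrite /maxn /minn; case: ifP => _ //; rewrite Rsym.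
have lec : maxn a b <= m by rewrite geq_max !ops_le.
move: dec => /=; case: ifP => // /andP[ltdc /orP[ltc|/andP[/eqP ec ltd]]] /eqP <-.
  exact: IHx.
by rewrite ec in Rcd ltdc *; apply: IHy.
Qed.

(** If [R] has a pair outside relation [i], the relation [j] attached to that pair lies in [R] by
    [pair_within] but not in relation [i]. Then [join_ok] supplies a listed relation of larger
    index, again inside [R]. Indices are bounded, so the climb ends at [R]. *)
Lemma cong_within i : i < size congs -> within m R (nth [::] congs i) ->
  exists2 j, j < size congs & con_rel r = label_set (nth [::] congs j).
Proof.
have [n] := ubnP (size congs - i).
elim: n i => // n IHn i ltn_n lti Ri.
have [/forallP all_in | ] := boolP [forall x : 'I_m.+1, forall y : 'I_m.+1,
    R x y ==> same (nth [::] congs i) x y].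
  exists i => //; apply/setP=> -[x y]; rewrite inE /=.
  have := all_in x => /forallP/(_ y)/implyP; rewrite /R !inord_val => sub_p.
  apply/idP/idP => // pxy.
  by have := Ri x y (leq_ord x) (leq_ord y) pxy; rewrite /R !inord_val.
case/forallPn=> x /forallPn[y]; rewrite negb_imply => /andP[].
(* The table of tested pairs covers only [y < x]. *)
wlog ltyx : x y / y < x => [gen Rxy npxy|Rxy npxy].
  have [/gen|/gen|exy] := ltngtP y x; first exact.
    by apply; [rewrite Rsym | rewrite /same eq_sym].
  by rewrite /same exy eqxx in npxy.
have Rj := pair_within (leq_ord x) ltyx Rxy.
set j := cong_of _ _ _ in Rj.
have := pairs_ok ltyx (leq_ord x); rewrite /pair_ok -/j; case: ifP => // ltj _.
have pjxy : same (nth [::] congs j) x y.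
  by apply: (@nth_find _ [::] (fun p => same p x y)); rewrite has_find.
have := joins_ok lti ltj; rewrite /join_ok; case: ifP => [fin|_].
  rewrite finer_sub // in fin; have /subsetP/(_ (x, y)) := fin.
  by rewrite !inE /= => /(_ pjxy) pxy; rewrite pxy in npxy.
case/hasP=> k; rewrite mem_iota subnKC // => /andP[ltik ltk] fin.
apply: (IHn k) => //; first by rewrite (leq_trans (ltn_sub2l lti ltik)).
have p_le z : z <= m -> nth 0 (nth [::] congs k) z <= m.
  by move=> lez; have [] := cong_label ltk lez.
apply: (finer_within Rsym Rtr p_le fin); apply: Rcl => //.
  exact: size_nth_congs.
move=> u uw; have wg : nth [::] (gens E) j \in gens E.
  by rewrite mem_nth // -size_congs.
have /andP[le1 le2] := gens_le wg uw; split=> //; apply: Rj => //.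
by have /and3P[_ _ /allP] := congs_ok ltj; apply.
Qed.

(** The climb starts at index 0, that is, at equality. *)
Lemma congruence_listed :
  exists2 j, j < size congs & con_rel r = label_set (nth [::] congs j).
Proof.
have [/and3P[_ _ g0] _ _ _ _] := and5P E_ok.
have lt0 : 0 < size congs by rewrite size_congs; case: (gens E) g0.
apply: (cong_within lt0).
have -> : nth [::] congs 0 = generated (iota 0 m.+1) [::].
  rewrite (nth_map [::]) -?size_congs //.
  by case: (gens E) g0 => // w ws /eqP /= ->.
by apply: Rcl; [rewrite size_iota | exact: iota_within |].
Qed.

End Complete.
End Representation.

(** * Small lattices *)

Definition tabulate (n : nat) (le : nat -> nat -> bool) : seq (seq bool) :=
  [seq [seq le a b | b <- iota 0 n] | a <- iota 0 n].

Lemma tabulateP n f g : tabulate n f = tabulate n g ->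
  forall a b, a < n -> b < n -> f a b = g a b.
Proof.
have n_in c : c < n -> c \in iota 0 n by rewrite mem_iota.
by move=> /eq_in_map fg a b /n_in/fg/eq_in_map fga /n_in/fga.
Qed.

Fixpoint bitseqs (k : nat) : seq bitseq :=
  if k is j.+1 then map (cons true) (bitseqs j) ++ map (cons false) (bitseqs j)
  else [:: [::]].

Lemma mem_bitseqs c : c \in bitseqs (size c).
Proof.
elim: c => //= b c IHc; rewrite mem_cat.
by case: b; rewrite map_f ?orbT.
Qed.

(* Strictly upper triangular matrices, as lists of columns. *)
Fixpoint triangles (k : nat) : seq (seq bitseq) :=
  if k is j.+1 then [seq rcons T c | T <- triangles j, c <- bitseqs j]
  else [:: [::]].

Lemma mem_triangles k (f : nat -> nat -> bool) :
  mkseq (fun b => mkseq (f^~ b) b) k \in triangles k.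
Proof.
elim: k => // k IHk; rewrite mkseqS /=.
apply/allpairsP; exists (mkseq (fun b => mkseq (f^~ b) b) k, mkseq (f^~ k) k).
by split=> //=; have := mem_bitseqs (mkseq (f^~ k) k); rewrite size_mkseq.
Qed.

(* An order on [0, ..., n.-1] of which the natural order is a linear extension,
   with bounds [0] and [n.-1]; [T] gives its restriction to the other elements. *)
Definition natural_le (n : nat) (T : seq (seq bool)) (a b : nat) : bool :=
  [|| a == b, a == 0, b == n.-1
    | (a < b) && nth false (nth [::] T b.-1) a.-1].

(** A filter that every lattice passes; with finitely many elements and a least one, joins yield the
    meets. The outer [if] makes the search for joins conditional under call-by-value evaluation,
    where [&&] computes both sides; [pair_ok], [join_ok] and [covers] use the same device. *)
Definition lattice_table (n : nat) (M : seq (seq bool)) : bool :=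
  let le a b := nth false (nth [::] M a) b in
  let r := iota 0 n in
  if all (fun a => all (fun b => all (fun c => le a b && le b c ==> le a c) r) r) r
  then all (fun a => all (fun b => has (fun c => [&& le a c, le b c &
             all (fun d => le a d && le b d ==> le c d) r]) r) r) r
  else false.

(** A linear extension of a bounded order starts at the bottom and ends at the top, so both ends
    stay fixed. For [n = 1] they coincide, and [take] removes the second copy. *)
Definition labelings (n : nat) : seq (seq nat) :=
  [seq take n (0 :: rcons s n.-1) | s <- permutations (iota 1 n.-2)].

Definition relabel (n : nat) (le : nat -> nat -> bool) (s : seq nat) : seq (seq bool) :=
  tabulate n (fun a b => le (nth 0 s a) (nth 0 s b)).

(** The matrix is bound before the abstraction over [a] and [b], so that evaluating [rep_le E]
    computes it once for all relabelings. *)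
Definition rep_le (E : unary_rep) : nat -> nat -> bool :=
  let ps := congs E in
  let M := [seq [seq finer (top_point E) p q | q <- ps] | p <- ps] in
  fun a b => nth false (nth [::] M a) b.

Definition rep_tables (reps : seq unary_rep) (n : nat) : seq (seq (seq bool)) :=
  flatten [seq (let le := rep_le E in [seq relabel n le s | s <- labelings n])
          | E <- reps & size (gens E) == n].

(** The type [unary_rep] carries no decidable equality here, so the property [Q] of the entries is
    carried along by induction instead of through list membership. *)
Lemma rep_tablesP (Q : pred unary_rep) reps n M :
  all Q reps -> M \in rep_tables reps n ->
  exists E s, [/\ Q E, size (gens E) = n, s \in labelings n & M = relabel n (rep_le E) s].
Proof.
elim: reps => // E reps IHreps /= /andP[QE /IHreps{}IHreps]; rewrite /rep_tables /=.
case: eqP => [szE | _] //=; rewrite mem_cat => /orP[/mapP[s s_lab ->] | //].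
by exists E, s.
Qed.

(** A linear extension with the bounds at the two ends, the places that [labelings] keeps fixed. *)
Definition L7_order : seq L7 := [:: L7_0; L7_j1; L7_j2; L7_m1; L7_m2; L7_k; L7_1].

Definition L7_tables : seq (seq (seq bool)) :=
  [seq relabel 7 (fun a b => L7_le (nth L7_0 L7_order a) (nth L7_0 L7_order b)) s
  | s <- labelings 7].

(* Only these can be of the form [tabulate n (natural_le n T)]. *)
Definition upper_triangular (M : seq (seq bool)) : bool :=
  all (fun a => all (fun b => ~~ nth false (nth [::] M a) b) (iota 0 a)) (iota 0 (size M)).

(** The first conjunct says that the labelings are permutations of [0, ..., n.-1]; it is the premise
    on [s] in [relabel_isomorphic], obtained by computation. *)
Definition covers (reps : seq unary_rep) (n : nat) : bool :=
  let Ms := [seq M <- (if n == 7 then L7_tables else [::]) ++ rep_tables reps n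
            | upper_triangular M] in
  all (fun s => [&& size s == n, uniq s & all (fun a => a < n) s]) (labelings n) &&
  all (fun T => let M := tabulate n (natural_le n T) in
                if lattice_table n M then M \in Ms else true)
      (triangles n.-2).

(** The preimage of the meet of two images is a common lower bound, hence lies below the meet;
    dually for joins. *)
Lemma surjective_embedding_isomorphic d (L : latticeType d) d' (M : latticeType d')
    (g : L -> M) :
  {mono g : x y / (x <= y)%O} -> (forall t, exists x, g x = t) ->
  lattice_isomorphic L M.
Proof.
move=> g_mono g_surj.
have gI : {morph g : x y / (x `&` y)%O}.
  move=> x y; apply/le_anti; rewrite lexI !g_mono leIl leIr /=.
  have [z ez] := g_surj (g x `&` g y)%O.
  by rewrite -ez g_mono lexI -!g_mono ez leIl leIr.
have gU : {morph g : x y / (x `|` y)%O}.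
  move=> x y; apply/le_anti; rewrite leUx !g_mono leUl leUr /= andbT.
  have [z ez] := g_surj (g x `|` g y)%O.
  by rewrite -ez g_mono leUx -!g_mono ez leUl leUr.
have gle : {homo g : x y / (x <= y)%O} by move=> x y; rewrite g_mono.
pose gO := Order.isOrderMorphism.Build d L d' M g gle.
pose go : {omorphism L -> M} := HB.pack g gO.
pose gL := Order.isLatticeMorphism.Build d L d' M go gI gU.
pose f : {lmorphism L -> M} := HB.pack g gO gL.
have [h gh] := choice g_surj.
exists f; exists h => // x; apply: (inc_inj g_mono); exact: gh.
Qed.

(** * The matrix of a lattice along a linear extension *)

Section LinearExtension.
Context (d : Order.disp_t) (L : finLatticeType d).
Variable x0 : L.
Let n := #|L|.

Let rank (x : L) := #|[set y : L | (y <= x)%O]|.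
Let e := sort (relpre rank leq) (enum L).
Let elt a := nth x0 e a.

Let mem_e x : x \in e. Proof. by rewrite mem_sort mem_enum. Qed.
Let size_e : size e = n. Proof. by rewrite size_sort -cardE. Qed.
Let uniq_e : uniq e. Proof. by rewrite sort_uniq enum_uniq. Qed.
Let index_lt x : index x e < n. Proof. by rewrite -size_e index_mem. Qed.
Let elt_index x : elt (index x e) = x. Proof. exact: nth_index. Qed.
Let index_elt a : a < n -> index (elt a) e = a.
Proof. by move=> lta; rewrite index_uniq ?size_e. Qed.

(** The list [e] is sorted by the size of principal ideals, and [x < y] makes the ideal of [x] a
    proper subset of that of [y]. *)
Lemma index_mono x y : (x < y)%O -> index x e < index y e.
Proof.
move=> ltxy; rewrite ltnNge; apply: contraL ltxy => le_yx; apply/negP=> ltxy.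
have : rank y <= rank x.
  apply: (@sorted_leq_index _ (relpre rank leq)) le_yx => //.
  - by move=> u v w /=; apply: leq_trans.
  - by move=> u /=.
  - by apply: sort_sorted => u v; apply: leq_total.
apply/negP; rewrite -ltnNge proper_card //; apply/properP; split.
  by apply/subsetP=> z; rewrite !inE => /le_trans; apply; apply: ltW.
by exists y; rewrite !inE // lt_geF.
Qed.

Lemma elt_mono a b : a < n -> b < n -> (elt a < elt b)%O -> a < b.
Proof. by move=> lta ltb /index_mono; rewrite !index_elt. Qed.

Let T := mkseq (fun b => mkseq (fun a => (elt a.+1 <= elt b.+1)%O) b) n.-2.

(** A linear extension has no relation below the diagonal and places the bounds at the ends, so [T]
    determines the whole order. *)
Lemma elt_le a b : a < n -> b < n -> (elt a <= elt b)%O = natural_le n T a b.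
Proof.
move=> lta ltb; rewrite /natural_le.
have [-> | neab] := eqVneq a b; first by rewrite lexx.
have ngt : (elt a <= elt b)%O -> a < b.
  move=> leab; apply: elt_mono => //; rewrite lt_neqAle leab andbT.
  by apply: contra neab => /eqP eab; rewrite -(index_elt lta) eab index_elt.
have [a0 | a_gt0] /= := posnP a.
  (* A meet strictly below [elt 0] would have an index smaller than 0. *)
  rewrite a0; suff /eqP <- : (elt 0 `&` elt b == elt 0)%O by exact: leIr.
  have := leIl (elt 0) (elt b); rewrite le_eqVlt => /orP[//|/index_mono].
  by rewrite index_elt // -a0.
have [bn | nebn] /= := eqVneq b n.-1.
  (* Dually, a join strictly above the last element would have an index beyond [n.-1]. *)
  have le_ab : (elt a <= elt a `|` elt b)%O := leUl _ _.
  suff /eqP eb : (elt a `|` elt b == elt b)%O by rewrite -eb.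
  have := leUr (elt b) (elt a); rewrite le_eqVlt => /orP[/eqP <- //|/index_mono].
  rewrite index_elt // bn => ltn.
  by have := leq_ltn_trans ltn (index_lt _); rewrite (ltn_predK lta) ltnn.
have [ltab | leba] /= := ltnP a b; last first.
  by apply/negbTE/negP => /ngt; rewrite ltnNge leba.
have b_gt0 : 0 < b := leq_trans a_gt0 (ltnW ltab).
(* [T] omits both bounds, which shifts its indices by one. *)
have ltbn : b.-1 < n.-2 by lia.
have ltab' : a.-1 < b.-1 by lia.
by rewrite /T !nth_mkseq // !prednK.
Qed.

Let M := tabulate n (natural_le n T).

Let nth_M a b : a < n -> b < n -> nth false (nth [::] M a) b = (elt a <= elt b)%O.
Proof.
move=> lta ltb; rewrite elt_le // (nth_map 0) ?size_iota //.
by rewrite (nth_map 0) ?size_iota // !nth_iota.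
Qed.

Lemma lattice_table_M : lattice_table n M.
Proof.
rewrite /lattice_table; case: ifP => [_|/negbT/negP[]].
  apply/allP=> a; rewrite mem_iota => /= lta.
  apply/allP=> b; rewrite mem_iota => /= ltb.
  apply/hasP; exists (index (elt a `|` elt b)%O e); first by rewrite mem_iota /=.
  rewrite !nth_M // !elt_index leUl leUr /=.
  apply/allP=> c; rewrite mem_iota => /= ltc.
  by rewrite !nth_M // elt_index leUx; apply/implyP.
apply/allP=> a; rewrite mem_iota => /= lta.
apply/allP=> b; rewrite mem_iota => /= ltb.
apply/allP=> c; rewrite mem_iota => /= ltc.
by rewrite !nth_M //; apply/implyP=> /andP[]; apply: le_trans.
Qed.

(** [M] is the order of [L] along [e], and the other matrix is the order of [K] along [c] composed
    with [s]. Their equality makes [g] an order embedding, and antisymmetry in [L] makes it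
    injective; in particular, listed congruences with such a table are distinct. *)
Lemma relabel_isomorphic d' (K : latticeType d') (c : nat -> K)
    (le : nat -> nat -> bool) (s : seq nat) :
  (forall a b, a < n -> b < n -> (c a <= c b)%O = le a b) ->
  (forall t, exists2 a, a < n & c a = t) ->
  [&& size s == n, uniq s & all (fun a => a < n) s] ->
  M = relabel n le s -> lattice_isomorphic L K.
Proof.
move=> c_le c_surj /and3P[/eqP szs uniq_s /allP s_lt] /tabulateP eM.
have sP a : a < n -> nth 0 s a < n by move=> lta; apply/s_lt/mem_nth; rewrite szs.
pose g x := c (nth 0 s (index x e)).
apply: (@surjective_embedding_isomorphic _ _ _ _ g) => [x y | t].
  by rewrite c_le ?sP // -eM // -elt_le // !elt_index.
have [a lta <-] := c_surj t.
(* Any [n] distinct numbers below [n] exhaust them. *)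
have as_ : a \in s.
  have [_ ->] : (size s = size (iota 0 n)) * (s =i iota 0 n).
    by apply: uniq_min_size; rewrite // ?size_iota ?szs // => b /s_lt; rewrite mem_iota.
  by rewrite mem_iota.
exists (elt (index a s)); rewrite /g index_elt ?nth_index //.
by rewrite -szs index_mem.
Qed.

(** The hypothesis is applied to the triangle [T] of [L] itself, which passes the lattice filter.
    Its matrix then occurs among the tables of [L7] or among those of an entry of [reps]. *)
Lemma rep_of_covers (reps : seq unary_rep) :
  all check_rep reps -> covers reps n ->
  lattice_isomorphic L L7 \/ exists A : finAlgebra, lattice_isomorphic L (Con A).
Proof.
move=> reps_ok /andP[/allP labP /allP/(_ T)].
move/(_ (mem_triangles _ _)); cbv zeta; rewrite lattice_table_M.
rewrite mem_filter mem_cat => /andP[_ /orP[]].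
  have [n7 | _] := eqVneq n 7; last by rewrite in_nil.
  case/mapP=> s s_lab eM; left; rewrite -n7 in s_lab eM.
  apply: (relabel_isomorphic _ _ (labP _ s_lab) eM) => // t.
  by exists (index t L7_order); [rewrite n7; case: t | case: t].
case/(rep_tablesP reps_ok) => E [s [E_ok szE s_lab eM]]; right.
exists (rep_algebra E).
have lt_size a : a < n -> a < size (congs E) by rewrite size_congs szE.
(* The total congruence serves only as the default value of [insubd]. *)
pose top := con_bigcap (pred0 : pred (Con (rep_algebra E))).
pose c a := insubd top (label_set E (nth [::] (congs E) a)).
have cE a : a < n -> con_rel (c a) = label_set E (nth [::] (congs E) a).
  by move=> lta; rewrite /c insubdK //; apply/asboolP/label_congruence/lt_size.
apply: (relabel_isomorphic (c := c) _ _ (labP _ s_lab) eM) => [a b lta ltb | r].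
  have -> : (c a <= c b)%O = (con_rel (c a) \subset con_rel (c b)) by [].
  rewrite !cE // -finer_sub ?lt_size //.
  by rewrite /rep_le (nth_map [::]) ?lt_size // (nth_map [::]) ?lt_size.
have [a lta er] := congruence_listed E_ok r.
rewrite size_congs szE in lta; exists a => //.
by apply: val_inj; rewrite /= cE.
Qed.

End LinearExtension.

(** * The representations *)

(* These were found by computer search among unary algebras with few points, coset
   actions of finite groups (the algebra with 90 points is the action of A_6 on the
   cosets of a subgroup of order 4), DeMeo's overalgebras, and sublattices of the
   congruence lattices of such algebras, in particular the unions of a filter and an
   ideal, which are again congruence lattices by a theorem of Snow.  Some of the
   algebras with 24 or more points have redundant operations, which make [pair_ok]
   cheap. *)
Definition catalog : seq unary_rep := [::
  UnaryRep 0 [::] [:: [::]];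
  UnaryRep 1 [::] [:: [::]; [:: (0, 1)]];
  UnaryRep 2 [:: [:: 1; 0; 2]] [:: [::]; [:: (0, 1)]; [:: (0, 2)]];
  UnaryRep 2 [:: [:: 1; 0; 1]] [:: [::]; [:: (0, 1)]; [:: (0, 2)]; [:: (1, 2)]];
  UnaryRep 3
    [:: [:: 1; 3; 3; 2];
        [:: 3; 3; 2; 3]]
    [:: [::]; [:: (2, 3)]; [:: (1, 2)]; [:: (0, 1)]];
  UnaryRep 2 [::] [:: [::]; [:: (0, 2)]; [:: (0, 1)]; [:: (1, 2)]; [:: (0, 1); (1, 2)]];
  UnaryRep 3
    [:: [:: 0; 1; 0; 1];
        [:: 1; 0; 3; 2]]
    [:: [::]; [:: (0, 1)]; [:: (0, 2)]; [:: (2, 3)]; [:: (1, 2)]];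
  UnaryRep 3
    [:: [:: 2; 0; 0; 2];
        [:: 3; 3; 3; 2];
        [:: 1; 0; 1; 1]]
    [:: [::]; [:: (0, 2)]; [:: (0, 3)]; [:: (0, 1)]; [:: (1, 3)]];
  UnaryRep 3
    [:: [:: 2; 2; 1; 1];
        [:: 0; 3; 3; 2]]
    [:: [::]; [:: (2, 3)]; [:: (1, 2)]; [:: (1, 3)]; [:: (0, 1)]];
  UnaryRep 4
    [:: [:: 0; 0; 3; 4; 1]]
    [:: [::]; [:: (0, 1)]; [:: (0, 4)]; [:: (0, 3)]; [:: (0, 2)]];
  UnaryRep 3
    [:: [:: 3; 3; 2; 2];
        [:: 3; 2; 3; 3]]
    [:: [::]; [:: (2, 3)]; [:: (1, 2)]; [:: (0, 2)]; [:: (0, 1)]; [:: (0, 2); (0, 1)]];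
  UnaryRep 3
    [:: [:: 1; 2; 1; 2];
        [:: 0; 3; 0; 3]]
    [:: [::]; [:: (1, 3)]; [:: (0, 2)]; [:: (1, 3); (0, 2)]; [:: (1, 2)]; [:: (0, 1)]];
  UnaryRep 3
    [:: [:: 0; 0; 2; 3];
        [:: 0; 2; 2; 2]]
    [:: [::]; [:: (2, 3)]; [:: (0, 2)]; [:: (0, 3)]; [:: (0, 1)]; [:: (1, 3)]];
  UnaryRep 3
    [:: [:: 2; 2; 2; 1];
        [:: 0; 0; 0; 1]]
    [:: [::]; [:: (0, 2)]; [:: (0, 1)]; [:: (1, 2)]; [:: (0, 1); (1, 2)]; [:: (0, 3)]];
  UnaryRep 4
    [:: [:: 3; 3; 4; 1; 2];
        [:: 0; 0; 3; 3; 1]]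
    [:: [::]; [:: (0, 1)]; [:: (0, 3)]; [:: (2, 4)]; [:: (2, 3)]; [:: (0, 2)]];
  UnaryRep 4
    [:: [:: 0; 4; 3; 2; 3];
        [:: 0; 3; 2; 2; 3];
        [:: 4; 3; 3; 3; 3]]
    [:: [::]; [:: (2, 3)]; [:: (2, 4)]; [:: (0, 2)]; [:: (1, 2)]; [:: (0, 1)]];
  UnaryRep 4
    [:: [:: 4; 2; 1; 3; 0];
        [:: 0; 4; 0; 1; 4]]
    [:: [::]; [:: (0, 4)]; [:: (1, 2)]; [:: (0, 2)]; [:: (0, 1)]; [:: (0, 3)]];
  UnaryRep 4
    [:: [:: 1; 3; 4; 3; 1];
        [:: 3; 1; 0; 1; 4]]
    [:: [::]; [:: (1, 3)]; [:: (1, 4)]; [:: (0, 1)]; [:: (0, 4)]; [:: (0, 2)]];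
  UnaryRep 4
    [:: [:: 4; 4; 2; 3; 3];
        [:: 4; 4; 4; 4; 2];
        [:: 4; 4; 1; 1; 0]]
    [:: [::]; [:: (2, 3)]; [:: (0, 1)]; [:: (2, 3); (0, 1)]; [:: (2, 4)]; [:: (0, 2)]];
  UnaryRep 5
    [:: [:: 2; 4; 0; 5; 1; 3];
        [:: 1; 3; 5; 0; 2; 4]]
    [:: [::]; [:: (1, 2)]; [:: (2, 3)]; [:: (0, 2)]; [:: (0, 1)]; [:: (0, 2); (0, 1)]];
  UnaryRep 5
    [:: [:: 3; 4; 5; 4; 3; 5];
        [:: 0; 2; 1; 5; 4; 3];
        [:: 2; 0; 0; 4; 5; 4]]
    [:: [::]; [:: (3, 4)]; [:: (1, 3)]; [:: (1, 2)]; [:: (0, 1)]; [:: (0, 3)]];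
  UnaryRep 5
    [:: [:: 2; 2; 0; 2; 2; 0];
        [:: 5; 1; 3; 5; 1; 3];
        [:: 5; 1; 1; 5; 1; 1];
        [:: 4; 5; 4; 1; 2; 1]]
    [:: [::]; [:: (1, 4)]; [:: (0, 2)]; [:: (0, 3)]; [:: (0, 4)]; [:: (0, 1)]];
  UnaryRep 5
    [:: [:: 0; 4; 0; 0; 3; 4];
        [:: 5; 4; 1; 5; 1; 2]]
    [:: [::]; [:: (0, 3)]; [:: (2, 4)]; [:: (1, 5)]; [:: (0, 2)]; [:: (0, 1)]];
  UnaryRep 6
    [:: [:: 6; 2; 6; 2; 0; 0; 6];
        [:: 2; 3; 2; 3; 4; 4; 2];
        [:: 5; 6; 1; 1; 1; 6; 6]]
    [:: [::]; [:: (1, 2)]; [:: (2, 4)]; [:: (0, 2)]; [:: (4, 5)]; [:: (0, 1)]];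
  UnaryRep 11
    [:: [:: 4; 11; 4; 4; 11; 11; 11; 11; 4; 4; 4; 11];
        [:: 1; 4; 7; 6; 0; 2; 9; 5; 11; 3; 8; 10];
        [:: 3; 6; 8; 0; 9; 10; 1; 11; 2; 4; 5; 7]]
    [:: [::]; [:: (0, 2)]; [:: (3, 5)]; [:: (1, 2)]; [:: (0, 1)]; [:: (1, 3)]];
  UnaryRep 3
    [:: [:: 1; 0; 3; 2]]
    [:: [::]; [:: (2, 3)]; [:: (0, 1)]; [:: (0, 2)]; [:: (1, 2)]; [:: (2, 3); (0, 1)];
        [:: (0, 1); (0, 2)]];
  UnaryRep 3
    [:: [:: 2; 3; 3; 3];
        [:: 3; 3; 3; 2]]
    [:: [::]; [:: (2, 3)]; [:: (1, 2)]; [:: (1, 3)]; [:: (0, 2)]; [:: (0, 1)];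
        [:: (0, 2); (0, 1)]];
  UnaryRep 3
    [:: [:: 1; 0; 0; 1];
        [:: 3; 3; 0; 0]]
    [:: [::]; [:: (0, 3)]; [:: (0, 1)]; [:: (1, 2)]; [:: (1, 3)]; [:: (2, 3)]; [:: (0, 2)]];
  UnaryRep 3
    [:: [:: 3; 3; 3; 2];
        [:: 0; 1; 2; 1]]
    [:: [::]; [:: (0, 2)]; [:: (0, 1)]; [:: (1, 2)]; [:: (1, 3)]; [:: (0, 1); (1, 2)];
        [:: (0, 3)]];
  UnaryRep 4
    [:: [:: 1; 0; 4; 0; 0];
        [:: 0; 1; 0; 4; 1];
        [:: 1; 0; 2; 3; 4]]
    [:: [::]; [:: (0, 1)]; [:: (0, 4)]; [:: (0, 2)]; [:: (2, 3)]; [:: (0, 3)];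
        [:: (0, 2); (0, 3)]];
  UnaryRep 4
    [:: [:: 2; 2; 3; 2; 3];
        [:: 1; 1; 4; 0; 4];
        [:: 1; 1; 0; 0; 1]]
    [:: [::]; [:: (0, 1)]; [:: (0, 3)]; [:: (2, 4)]; [:: (0, 3); (2, 4)]; [:: (2, 3)];
        [:: (0, 2)]];
  UnaryRep 4
    [:: [:: 2; 3; 2; 3; 2];
        [:: 2; 2; 0; 0; 0];
        [:: 3; 3; 1; 1; 1];
        [:: 0; 1; 2; 3; 0]]
    [:: [::]; [:: (2, 3)]; [:: (0, 1)]; [:: (0, 2)]; [:: (1, 2)]; [:: (0, 4)]; [:: (1, 4)]];
  UnaryRep 4
    [:: [:: 4; 0; 3; 2; 0];
        [:: 4; 0; 0; 1; 0]]
    [:: [::]; [:: (0, 4)]; [:: (1, 4)]; [:: (0, 1)]; [:: (2, 3)]; [:: (1, 2)]; [:: (0, 2)]];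
  UnaryRep 4
    [:: [:: 3; 2; 3; 2; 3];
        [:: 4; 4; 2; 2; 4];
        [:: 1; 0; 1; 0; 1];
        [:: 1; 1; 3; 3; 1]]
    [:: [::]; [:: (0, 4)]; [:: (0, 1)]; [:: (1, 3)]; [:: (1, 4)]; [:: (0, 2)]; [:: (1, 2)]];
  UnaryRep 4
    [:: [:: 3; 3; 4; 0; 2];
        [:: 1; 0; 3; 3; 1]]
    [:: [::]; [:: (0, 1)]; [:: (0, 3)]; [:: (2, 3)]; [:: (2, 4)]; [:: (1, 4)]; [:: (0, 2)]];
  UnaryRep 4
    [:: [:: 0; 3; 0; 3; 3];
        [:: 2; 3; 0; 2; 0];
        [:: 3; 1; 4; 0; 2]]
    [:: [::]; [:: (0, 3)]; [:: (2, 4)]; [:: (0, 2)]; [:: (2, 3)]; [:: (1, 2)]; [:: (0, 1)]];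
  UnaryRep 4
    [:: [:: 3; 1; 3; 2; 4];
        [:: 1; 3; 1; 1; 1];
        [:: 4; 3; 3; 3; 3]]
    [:: [::]; [:: (2, 3)]; [:: (1, 2)]; [:: (2, 4)]; [:: (0, 2)]; [:: (1, 4)]; [:: (0, 1)]];
  UnaryRep 4
    [:: [:: 2; 3; 2; 3; 2];
        [:: 0; 2; 0; 2; 0];
        [:: 1; 2; 1; 2; 3];
        [:: 0; 0; 0; 0; 2]]
    [:: [::]; [:: (1, 3)]; [:: (0, 2)]; [:: (1, 3); (0, 2)]; [:: (0, 1)]; [:: (0, 4)];
        [:: (1, 4)]];
  UnaryRep 4
    [:: [:: 4; 2; 2; 2; 2];
        [:: 0; 4; 2; 3; 1];
        [:: 3; 2; 2; 2; 2];
        [:: 1; 1; 4; 1; 1]]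
    [:: [::]; [:: (1, 4)]; [:: (1, 3)]; [:: (2, 3)]; [:: (1, 2)]; [:: (1, 3); (1, 2)];
        [:: (0, 1)]];
  UnaryRep 4
    [:: [:: 2; 2; 2; 2; 4];
        [:: 1; 1; 3; 3; 1];
        [:: 0; 0; 2; 2; 1]]
    [:: [::]; [:: (2, 3)]; [:: (0, 1)]; [:: (2, 3); (0, 1)]; [:: (0, 2)]; [:: (1, 2)];
        [:: (0, 4)]];
  UnaryRep 4
    [:: [:: 0; 0; 2; 2; 0];
        [:: 1; 1; 1; 1; 0];
        [:: 0; 0; 3; 3; 2]]
    [:: [::]; [:: (2, 3)]; [:: (0, 1)]; [:: (2, 3); (0, 1)]; [:: (0, 2)]; [:: (1, 2)];
        [:: (0, 4)]];
  UnaryRep 4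
    [:: [:: 3; 2; 3; 3; 0];
        [:: 2; 0; 2; 2; 4];
        [:: 3; 3; 3; 3; 1]]
    [:: [::]; [:: (0, 3)]; [:: (2, 3)]; [:: (0, 2)]; [:: (0, 3); (0, 2)]; [:: (0, 1)];
        [:: (0, 4)]];
  UnaryRep 5
    [:: [:: 2; 5; 2; 2; 5; 5];
        [:: 2; 0; 3; 0; 2; 3];
        [:: 5; 4; 1; 4; 5; 1]]
    [:: [::]; [:: (2, 5)]; [:: (0, 4)]; [:: (1, 3)]; [:: (0, 4); (1, 3)]; [:: (0, 2)];
        [:: (0, 1)]];
  UnaryRep 5
    [:: [:: 2; 2; 4; 4; 1; 1];
        [:: 0; 1; 1; 0; 4; 5];
        [:: 0; 0; 3; 3; 3; 3];
        [:: 1; 0; 5; 4; 5; 4]]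
    [:: [::]; [:: (4, 5)]; [:: (0, 1)]; [:: (4, 5); (0, 1)]; [:: (2, 3)]; [:: (1, 2)];
        [:: (0, 2)]];
  UnaryRep 5
    [:: [:: 0; 3; 0; 3; 3; 3];
        [:: 4; 4; 3; 5; 3; 5];
        [:: 2; 0; 0; 2; 2; 2];
        [:: 3; 1; 1; 3; 4; 3]]
    [:: [::]; [:: (3, 5)]; [:: (3, 4)]; [:: (0, 3)]; [:: (1, 2)]; [:: (0, 2)]; [:: (0, 1)]];
  UnaryRep 5
    [:: [:: 5; 4; 5; 4; 4; 4];
        [:: 3; 3; 1; 1; 5; 5];
        [:: 2; 3; 0; 3; 4; 4];
        [:: 2; 0; 0; 0; 0; 2]]
    [:: [::]; [:: (1, 3)]; [:: (0, 2)]; [:: (4, 5)]; [:: (0, 1)]; [:: (1, 4)]; [:: (0, 4)]];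
  UnaryRep 5
    [:: [:: 0; 0; 3; 3; 0; 3];
        [:: 3; 4; 0; 0; 5; 4];
        [:: 2; 4; 3; 3; 3; 2]]
    [:: [::]; [:: (2, 3)]; [:: (0, 2)]; [:: (0, 4)]; [:: (4, 5)]; [:: (2, 4)]; [:: (0, 1)]];
  UnaryRep 5
    [:: [:: 0; 4; 0; 0; 3; 4];
        [:: 0; 3; 5; 3; 0; 2];
        [:: 1; 4; 3; 1; 1; 0]]
    [:: [::]; [:: (0, 3)]; [:: (0, 4)]; [:: (0, 1)]; [:: (2, 5)]; [:: (0, 1); (2, 5)];
        [:: (0, 2)]];
  UnaryRep 5
    [:: [:: 4; 1; 3; 2; 0; 5];
        [:: 5; 1; 5; 5; 5; 2];
        [:: 2; 3; 2; 3; 3; 2];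
        [:: 3; 2; 4; 4; 3; 2]]
    [:: [::]; [:: (2, 3)]; [:: (0, 4)]; [:: (0, 2)]; [:: (0, 3)]; [:: (0, 5)]; [:: (0, 1)]];
  UnaryRep 5
    [:: [:: 1; 2; 3; 2; 1; 2];
        [:: 0; 5; 0; 5; 5; 1];
        [:: 3; 3; 1; 1; 5; 5]]
    [:: [::]; [:: (1, 3)]; [:: (1, 5)]; [:: (0, 2)]; [:: (1, 5); (0, 2)]; [:: (0, 1)];
        [:: (0, 4)]];
  UnaryRep 5
    [:: [:: 1; 5; 1; 5; 5; 1];
        [:: 0; 2; 0; 2; 4; 2];
        [:: 0; 4; 0; 0; 3; 4]]
    [:: [::]; [:: (1, 5)]; [:: (0, 2)]; [:: (1, 5); (0, 2)]; [:: (0, 3)]; [:: (0, 4)];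
        [:: (0, 1)]];
  UnaryRep 6
    [:: [:: 5; 4; 3; 4; 3; 5; 5];
        [:: 6; 2; 6; 4; 5; 5; 0];
        [:: 1; 6; 1; 6; 1; 1; 1];
        [:: 5; 4; 5; 2; 6; 0; 5]]
    [:: [::]; [:: (0, 6)]; [:: (0, 5)]; [:: (2, 4)]; [:: (1, 3)]; [:: (0, 1)]; [:: (0, 3)]];
  UnaryRep 6
    [:: [:: 6; 6; 0; 6; 0; 6; 0];
        [:: 3; 2; 1; 3; 1; 2; 1];
        [:: 5; 3; 1; 1; 1; 0; 5];
        [:: 4; 2; 2; 4; 4; 4; 2]]
    [:: [::]; [:: (2, 4)]; [:: (0, 3)]; [:: (1, 2)]; [:: (2, 6)]; [:: (0, 5)]; [:: (0, 1)]];
  UnaryRep 6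
    [:: [:: 4; 5; 3; 5; 5; 5; 4];
        [:: 5; 5; 2; 6; 0; 1; 1];
        [:: 0; 3; 0; 3; 3; 3; 0]]
    [:: [::]; [:: (1, 5)]; [:: (0, 6)]; [:: (3, 4)]; [:: (0, 1)]; [:: (0, 4)]; [:: (0, 2)]];
  UnaryRep 6
    [:: [:: 2; 6; 6; 6; 5; 2; 2];
        [:: 6; 6; 0; 5; 0; 5; 0];
        [:: 0; 1; 1; 3; 0; 5; 0];
        [:: 1; 1; 3; 3; 1; 3; 3]]
    [:: [::]; [:: (0, 1)]; [:: (1, 3)]; [:: (3, 5)]; [:: (1, 2)]; [:: (0, 2)]; [:: (0, 4)]];
  UnaryRep 6
    [:: [:: 1; 6; 4; 5; 5; 4; 1];
        [:: 0; 4; 2; 0; 1; 6; 4];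
        [:: 3; 2; 0; 0; 2; 2; 2]]
    [:: [::]; [:: (1, 6)]; [:: (4, 5)]; [:: (1, 4)]; [:: (0, 3)]; [:: (0, 2)]; [:: (0, 1)]];
  UnaryRep 8
    [:: [:: 5; 6; 2; 6; 2; 5; 6; 5; 2];
        [:: 0; 1; 2; 0; 0; 2; 2; 1; 1];
        [:: 7; 1; 8; 1; 8; 7; 1; 7; 8];
        [:: 0; 3; 4; 3; 4; 0; 3; 0; 4];
        [:: 0; 7; 5; 7; 5; 0; 7; 0; 5]]
    [:: [::]; [:: (0, 1)]; [:: (0, 2)]; [:: (3, 6)]; [:: (4, 8)]; [:: (1, 2)]; [:: (2, 3)]];
  UnaryRep 8
    [:: [:: 0; 1; 2; 0; 1; 1; 2; 1; 2];
        [:: 5; 5; 5; 7; 5; 7; 7; 7; 5];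
        [:: 8; 8; 6; 6; 6; 6; 8; 8; 6];
        [:: 0; 1; 2; 2; 2; 0; 0; 0; 0];
        [:: 0; 5; 6; 0; 5; 5; 6; 5; 6];
        [:: 3; 4; 2; 3; 4; 4; 2; 4; 2]]
    [:: [::]; [:: (5, 7)]; [:: (0, 1)]; [:: (0, 2)]; [:: (1, 2)]; [:: (4, 5)]; [:: (1, 3)]];
  UnaryRep 8
    [:: [:: 1; 8; 7; 4; 6; 2; 3; 5; 0];
        [:: 5; 5; 5; 5; 3; 5; 5; 3; 3];
        [:: 1; 6; 6; 6; 6; 1; 1; 6; 6]]
    [:: [::]; [:: (1, 3)]; [:: (2, 3)]; [:: (1, 2)]; [:: (1, 3); (1, 2)]; [:: (0, 2)];
        [:: (0, 1)]];
  UnaryRep 8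
    [:: [:: 7; 3; 5; 1; 0; 6; 2; 4; 8];
        [:: 5; 8; 7; 1; 6; 0; 4; 2; 3];
        [:: 6; 7; 6; 5; 6; 6; 6; 6; 8]]
    [:: [::]; [:: (4, 5)]; [:: (2, 4)]; [:: (0, 2)]; [:: (0, 4)]; [:: (0, 2); (0, 4)];
        [:: (0, 1)]];
  UnaryRep 9
    [:: [:: 7; 8; 2; 9; 8; 2; 9; 7; 8; 9];
        [:: 0; 1; 2; 3; 0; 0; 0; 2; 2; 2];
        [:: 0; 4; 5; 6; 4; 5; 6; 0; 4; 6];
        [:: 1; 0; 3; 2; 0; 3; 2; 1; 0; 2];
        [:: 7; 7; 7; 7; 7; 0; 0; 5; 5; 7]]
    [:: [::]; [:: (0, 1)]; [:: (2, 3)]; [:: (0, 2)]; [:: (0, 1); (2, 3)]; [:: (4, 8)];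
        [:: (1, 2)]];
  UnaryRep 9
    [:: [:: 2; 9; 9; 2; 8; 4; 3; 8; 7; 2];
        [:: 0; 1; 2; 3; 3; 3; 3; 2; 2; 2];
        [:: 4; 5; 6; 3; 4; 5; 6; 4; 5; 3];
        [:: 0; 1; 2; 3; 0; 1; 2; 0; 1; 3]]
    [:: [::]; [:: (2, 3)]; [:: (4, 7)]; [:: (5, 8)]; [:: (1, 2)]; [:: (0, 1)]; [:: (0, 2)]];
  UnaryRep 9
    [:: [:: 0; 1; 2; 3; 0; 2; 3; 0; 1; 3];
        [:: 4; 1; 5; 6; 4; 5; 6; 4; 1; 6];
        [:: 6; 6; 6; 7; 6; 6; 4; 6; 6; 9];
        [:: 0; 1; 2; 3; 1; 1; 1; 2; 2; 2];
        [:: 0; 0; 0; 1; 0; 0; 1; 0; 0; 1];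
        [:: 7; 8; 2; 9; 7; 2; 9; 7; 8; 9]]
    [:: [::]; [:: (0, 1)]; [:: (1, 2)]; [:: (0, 2)]; [:: (4, 7)]; [:: (2, 4)]; [:: (0, 3)]];
  UnaryRep 10
    [:: [:: 5; 1; 4; 8; 8; 1; 2; 1; 2; 1; 1];
        [:: 7; 1; 8; 7; 1; 1; 8; 7; 8; 7; 1];
        [:: 0; 5; 6; 0; 5; 5; 6; 0; 6; 0; 5];
        [:: 3; 4; 8; 9; 10; 4; 10; 3; 10; 9; 10];
        [:: 0; 1; 2; 2; 2; 0; 0; 1; 1; 2; 2]]
    [:: [::]; [:: (0, 1)]; [:: (1, 2)]; [:: (6, 8)]; [:: (3, 9)]; [:: (3, 7)]; [:: (0, 2)]];
  UnaryRep 11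
    [:: [:: 1; 4; 7; 6; 0; 2; 9; 5; 11; 3; 8; 10];
        [:: 4; 9; 4; 4; 4; 4; 4; 9; 9; 4; 9; 4];
        [:: 2; 5; 0; 8; 7; 1; 10; 4; 3; 11; 6; 9];
        [:: 3; 6; 8; 0; 9; 10; 1; 11; 2; 4; 5; 7]]
    [:: [::]; [:: (0, 3)]; [:: (2, 4)]; [:: (1, 2)]; [:: (0, 2)]; [:: (0, 1)];
        [:: (0, 2); (0, 1)]];
  UnaryRep 12
    [:: [:: 7; 1; 11; 5; 7; 1; 11; 1; 11; 5; 7; 1; 5];
        [:: 0; 1; 2; 3; 3; 3; 3; 0; 0; 0; 2; 2; 2];
        [:: 1; 2; 1; 2; 1; 2; 1; 2; 1; 2; 1; 2; 2];
        [:: 10; 11; 2; 12; 10; 11; 2; 11; 2; 12; 10; 11; 12];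
        [:: 4; 7; 6; 9; 3; 9; 3; 0; 4; 0; 6; 8; 8]]
    [:: [::]; [:: (1, 3)]; [:: (0, 2)]; [:: (9, 12)]; [:: (1, 2)]; [:: (9, 11)]; [:: (0, 1)]];
  UnaryRep 15
    [:: [:: 2; 4; 7; 1; 3; 11; 5; 0; 10; 13; 12; 6; 8; 15; 14; 9];
        [:: 3; 5; 8; 0; 10; 1; 12; 11; 2; 14; 4; 7; 6; 15; 9; 13];
        [:: 1; 0; 6; 5; 9; 3; 2; 13; 12; 4; 14; 15; 8; 7; 10; 11]]
    [:: [::]; [:: (1, 2)]; [:: (2, 3)]; [:: (0, 2)]; [:: (0, 1)]; [:: (1, 3)];
        [:: (0, 1); (1, 3)]];
  UnaryRep 15
    [:: [:: 6; 7; 2; 8; 9; 10; 6; 7; 8; 9; 10; 7; 2; 8; 9; 10];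
        [:: 1; 0; 4; 5; 2; 3; 1; 0; 5; 2; 3; 0; 4; 5; 2; 3];
        [:: 4; 5; 3; 2; 0; 1; 4; 5; 2; 0; 1; 5; 3; 2; 0; 1];
        [:: 0; 1; 2; 3; 4; 5; 2; 2; 2; 2; 2; 0; 0; 0; 0; 0];
        [:: 0; 11; 12; 13; 14; 15; 0; 11; 13; 14; 15; 11; 12; 13; 14; 15]]
    [:: [::]; [:: (0, 1)]; [:: (1, 2)]; [:: (0, 3)]; [:: (0, 2)]; [:: (7, 11)]; [:: (1, 6)]];
  UnaryRep 15
    [:: [:: 2; 3; 0; 1; 3; 0; 1; 11; 12; 10; 2; 0; 1; 5; 6; 4];
        [:: 0; 1; 2; 3; 0; 0; 0; 3; 3; 3; 1; 1; 1; 2; 2; 2];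
        [:: 13; 14; 2; 15; 14; 2; 15; 13; 14; 2; 13; 2; 15; 13; 14; 15];
        [:: 8; 7; 3; 9; 7; 3; 9; 9; 9; 9; 8; 3; 9; 3; 3; 3]]
    [:: [::]; [:: (1, 2)]; [:: (0, 2)]; [:: (0, 1)]; [:: (5, 11)]; [:: (7, 13)]; [:: (2, 4)]];
  UnaryRep 23
    [:: [:: 3; 6; 1; 3; 0; 0; 6; 1; 0; 3; 3; 0; 1; 6; 3; 1; 0; 6; 0; 1; 6; 1; 3; 6];
        [:: 4; 7; 9; 11; 0; 13; 15; 1; 17; 2; 18; 3; 20; 5; 21; 6; 22; 8; 10; 23; 12; 14; 16;
            19];
        [:: 20; 17; 15; 23; 8; 15; 22; 8; 21; 6; 7; 19; 18; 3; 4; 16; 9; 10; 0; 9; 10; 1; 2; 5];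
        [:: 10; 10; 16; 5; 18; 19; 2; 21; 0; 22; 8; 9; 0; 22; 8; 9; 6; 4; 17; 3; 7; 20; 15; 15]]
    [:: [::]; [:: (0, 1)]; [:: (2, 4)]; [:: (0, 3)]; [:: (0, 4)]; [:: (0, 2)]; [:: (4, 8)]];
  UnaryRep 23
    [:: [:: 3; 6; 8; 0; 10; 11; 1; 13; 2; 16; 4; 5; 18; 7; 20; 21; 9; 22; 12; 23; 14; 15; 17;
            19];
        [:: 1; 4; 7; 6; 0; 2; 10; 5; 11; 15; 3; 13; 9; 8; 19; 12; 18; 14; 21; 17; 23; 16; 20;
            22];
        [:: 2; 5; 0; 9; 7; 1; 12; 4; 14; 3; 15; 17; 6; 19; 8; 10; 20; 11; 22; 13; 16; 23; 18;
            21];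
        [:: 19; 4; 15; 19; 4; 15; 19; 15; 21; 21; 19; 21; 21; 21; 19; 21; 15; 19; 15; 19; 19;
            15; 4; 4]]
    [:: [::]; [:: (8, 9)]; [:: (5, 8)]; [:: (0, 3)]; [:: (0, 1)]; [:: (1, 3)]; [:: (0, 2)]];
  UnaryRep 31
    [:: [:: 9; 9; 17; 9; 17; 17; 9; 17; 9; 17; 9; 9; 17; 9; 9; 17; 17; 9; 9; 17; 9; 17; 17; 9;
            17; 17; 17; 17; 9; 9; 17; 9];
        [:: 3; 5; 7; 9; 11; 14; 16; 17; 18; 0; 13; 22; 19; 23; 1; 12; 25; 2; 21; 15; 20; 8; 4;
            10; 27; 6; 26; 28; 24; 31; 29; 30];
        [:: 1; 0; 6; 8; 10; 12; 2; 13; 3; 19; 4; 16; 5; 7; 18; 21; 11; 22; 14; 9; 27; 15; 17;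
            25; 28; 23; 30; 20; 24; 31; 26; 29];
        [:: 2; 4; 0; 7; 1; 13; 15; 3; 16; 20; 21; 12; 11; 5; 24; 6; 8; 26; 27; 28; 9; 10; 29;
            30; 14; 31; 17; 18; 19; 22; 23; 25];
        [:: 27; 28; 30; 6; 31; 10; 29; 1; 4; 13; 26; 0; 2; 15; 7; 24; 21; 8; 11; 16; 19; 20; 5;
            12; 9; 3; 22; 18; 14; 25; 23; 17]]
    [:: [::]; [:: (0, 2)]; [:: (1, 3)]; [:: (1, 5)]; [:: (0, 3)]; [:: (0, 1)]; [:: (3, 4)]];
  UnaryRep 33
    [:: [:: 4; 11; 4; 4; 11; 11; 11; 11; 4; 4; 4; 11; 4; 11; 4; 11; 11; 11; 11; 4; 4; 4; 11; 4;
            11; 4; 4; 11; 11; 11; 4; 4; 4; 11];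
        [:: 0; 1; 2; 3; 4; 5; 6; 7; 8; 9; 10; 11; 2; 2; 2; 2; 2; 2; 2; 2; 2; 2; 2; 5; 5; 5; 5;
            5; 5; 5; 5; 5; 5; 5];
        [:: 23; 24; 25; 26; 27; 5; 28; 29; 30; 31; 32; 33; 23; 24; 26; 27; 5; 28; 29; 30; 31;
            32; 33; 23; 24; 25; 26; 27; 28; 29; 30; 31; 32; 33];
        [:: 1; 4; 7; 6; 0; 2; 9; 5; 11; 3; 8; 10; 1; 4; 6; 0; 2; 9; 5; 11; 3; 8; 10; 1; 4; 7;
            6; 0; 9; 5; 11; 3; 8; 10];
        [:: 3; 6; 8; 0; 9; 10; 1; 11; 2; 4; 5; 7; 3; 6; 0; 9; 10; 1; 11; 2; 4; 5; 7; 3; 6; 8;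
            0; 9; 1; 11; 2; 4; 5; 7];
        [:: 12; 13; 2; 14; 15; 16; 17; 18; 19; 20; 21; 22; 12; 13; 14; 15; 16; 17; 18; 19; 20;
            21; 22; 12; 13; 2; 14; 15; 17; 18; 19; 20; 21; 22]]
    [:: [::]; [:: (3, 5)]; [:: (0, 2)]; [:: (1, 2)]; [:: (0, 1)]; [:: (12, 23)]; [:: (1, 3)]];
  UnaryRep 33
    [:: [:: 12; 13; 14; 15; 16; 17; 6; 18; 19; 20; 21; 22; 12; 13; 14; 15; 16; 17; 18; 19; 20;
            21; 22; 12; 13; 14; 15; 16; 17; 6; 18; 19; 20; 21];
        [:: 1; 4; 7; 6; 0; 2; 9; 5; 11; 3; 8; 10; 1; 4; 7; 6; 0; 2; 5; 11; 3; 8; 10; 1; 4; 7;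
            6; 0; 2; 9; 5; 11; 3; 8];
        [:: 5; 7; 4; 10; 2; 0; 11; 1; 9; 8; 3; 6; 4; 27; 4; 4; 11; 11; 27; 4; 4; 4; 11; 5; 7;
            4; 10; 2; 0; 11; 1; 9; 8; 3];
        [:: 23; 24; 25; 26; 27; 28; 29; 30; 31; 32; 33; 11; 23; 24; 25; 26; 27; 28; 30; 31; 32;
            33; 11; 23; 24; 25; 26; 27; 28; 29; 30; 31; 32; 33];
        [:: 3; 6; 8; 0; 9; 10; 1; 11; 2; 4; 5; 7; 3; 6; 8; 0; 9; 10; 11; 2; 4; 5; 7; 3; 6; 8;
            0; 9; 10; 1; 11; 2; 4; 5];
        [:: 0; 1; 2; 3; 4; 5; 6; 7; 8; 9; 10; 11; 6; 6; 6; 6; 6; 6; 6; 6; 6; 6; 6; 11; 11; 11;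
            11; 11; 11; 11; 11; 11; 11; 11]]
    [:: [::]; [:: (0, 2)]; [:: (3, 5)]; [:: (12, 23)]; [:: (1, 2)]; [:: (0, 1)]; [:: (1, 3)]];
  UnaryRep 47
    [:: [:: 4; 6; 8; 10; 12; 14; 15; 17; 18; 20; 21; 23; 24; 26; 27; 29; 31; 32; 34; 35; 30;
            37; 38; 25; 0; 41; 22; 42; 40; 1; 44; 19; 45; 43; 2; 16; 46; 3; 13; 47; 39; 11; 5;
            36; 9; 7; 33; 28];
        [:: 46; 7; 7; 7; 7; 7; 7; 7; 7; 7; 7; 7; 7; 7; 7; 7; 7; 7; 7; 7; 7; 7; 7; 7; 7; 7; 7;
            7; 7; 7; 46; 7; 7; 7; 7; 7; 7; 7; 7; 7; 7; 7; 7; 7; 7; 7; 7; 7];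
        [:: 5; 7; 9; 11; 13; 0; 16; 1; 19; 2; 22; 3; 25; 4; 28; 30; 6; 33; 32; 8; 36; 27; 10;
            39; 40; 12; 42; 21; 14; 43; 15; 45; 18; 17; 46; 44; 20; 47; 41; 23; 24; 38; 26; 29;
            35; 31; 34; 37];
        [:: 1; 3; 0; 2; 6; 7; 10; 11; 4; 5; 8; 9; 15; 16; 17; 21; 22; 23; 12; 13; 14; 18; 19;
            20; 29; 30; 31; 32; 33; 37; 27; 38; 25; 39; 24; 26; 28; 34; 35; 36; 43; 44; 45; 47;
            42; 41; 40; 46];
        [:: 24; 29; 34; 37; 0; 42; 1; 45; 2; 44; 3; 41; 4; 38; 5; 6; 35; 7; 8; 31; 9; 10; 26;
            11; 12; 23; 13; 14; 47; 15; 20; 16; 17; 46; 18; 19; 43; 21; 22; 40; 28; 25; 27; 33;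
            30; 32; 36; 39];
        [:: 23; 20; 17; 14; 28; 10; 33; 8; 36; 6; 39; 4; 42; 3; 13; 45; 2; 16; 44; 1; 19; 41;
            0; 22; 38; 37; 25; 24; 11; 35; 34; 30; 29; 9; 31; 32; 7; 26; 27; 5; 21; 40; 47; 18;
            43; 46; 15; 12];
        [:: 25; 30; 32; 27; 40; 21; 43; 18; 46; 15; 47; 12; 5; 10; 26; 7; 8; 31; 9; 6; 35; 11;
            4; 38; 13; 3; 41; 0; 23; 16; 2; 44; 1; 20; 19; 45; 17; 22; 42; 14; 37; 39; 28; 34;
            36; 33; 29; 24]]
    [:: [::]; [:: (9, 12)]; [:: (3, 4)]; [:: (1, 2)]; [:: (0, 1)]; [:: (0, 5)]; [:: (1, 5)]];
  UnaryRep 89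
    [:: [:: 3; 7; 11; 15; 18; 21; 24; 27; 30; 32; 28; 37; 29; 36; 10; 0; 19; 39; 52; 23; 54;
            57; 50; 16; 48; 17; 59; 1; 14; 60; 35; 68; 43; 22; 74; 8; 62; 2; 40; 25; 63; 82;
            26; 9; 78; 34; 44; 49; 6; 77; 33; 61; 4; 84; 71; 58; 86; 5; 87; 42; 12; 75; 13; 38;
            53; 66; 76; 79; 81; 85; 56; 20; 73; 88; 45; 51; 65; 47; 46; 80; 67; 31; 83; 41; 64;
            89; 70; 55; 72; 69];
        [:: 1; 5; 9; 13; 8; 0; 10; 26; 22; 31; 34; 36; 33; 41; 43; 45; 42; 50; 51; 14; 23; 56;
            4; 38; 59; 35; 44; 63; 62; 30; 67; 2; 70; 69; 6; 75; 77; 27; 20; 61; 73; 3; 83; 19;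
            7; 71; 32; 24; 57; 54; 85; 58; 80; 21; 86; 52; 53; 81; 18; 47; 79; 76; 64; 37; 28;
            60; 87; 29; 72; 12; 46; 15; 82; 84; 88; 25; 39; 11; 74; 65; 55; 48; 68; 16; 40; 17;
            49; 89; 78; 66];
        [:: 84; 78; 31; 63; 11; 82; 85; 75; 24; 70; 69; 65; 28; 5; 60; 30; 10; 38; 45; 39; 56;
            62; 54; 81; 47; 16; 22; 18; 23; 51; 80; 19; 9; 21; 4; 3; 55; 52; 0; 66; 25; 26; 59;
            87; 67; 79; 27; 44; 35; 6; 42; 1; 7; 34; 88; 32; 43; 50; 13; 83; 49; 12; 86; 89;
            15; 53; 2; 8; 37; 40; 36; 33; 20; 58; 64; 68; 17; 29; 77; 46; 74; 61; 73; 57; 76;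
            14; 71; 72; 41; 48];
        [:: 15; 27; 37; 0; 52; 57; 48; 1; 35; 43; 14; 2; 60; 62; 28; 3; 23; 25; 4; 16; 71; 5;
            33; 19; 6; 39; 42; 7; 10; 12; 8; 81; 9; 50; 45; 30; 13; 11; 63; 17; 38; 83; 59; 32;
            46; 74; 78; 77; 24; 47; 22; 75; 18; 64; 20; 87; 70; 21; 55; 26; 29; 51; 36; 40; 84;
            76; 65; 80; 31; 89; 86; 54; 88; 72; 34; 61; 66; 49; 44; 67; 79; 68; 41; 82; 53; 69;
            56; 58; 73; 85];
        [:: 31; 34; 6; 19; 85; 38; 20; 43; 67; 1; 5; 71; 76; 7; 26; 70; 81; 29; 4; 56; 2; 14;
            51; 0; 37; 65; 21; 62; 63; 58; 22; 23; 45; 80; 9; 75; 32; 88; 10; 55; 57; 53; 40;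
            13; 41; 36; 77; 78; 73; 84; 8; 30; 69; 44; 48; 66; 3; 42; 17; 28; 25; 33; 74; 59;
            47; 60; 39; 50; 15; 89; 68; 72; 11; 54; 27; 79; 87; 82; 64; 35; 61; 86; 46; 49; 83;
            18; 16; 12; 24; 52];
        [:: 10; 23; 0; 44; 30; 9; 1; 53; 18; 20; 2; 46; 52; 56; 3; 11; 84; 4; 29; 7; 5; 41; 50;
            6; 64; 35; 13; 24; 78; 8; 17; 34; 82; 87; 38; 60; 72; 28; 31; 12; 49; 43; 86; 21;
            14; 68; 15; 63; 16; 81; 58; 85; 39; 19; 83; 33; 26; 54; 22; 88; 25; 66; 59; 74; 27;
            75; 69; 51; 77; 61; 36; 32; 70; 42; 47; 79; 80; 45; 37; 65; 89; 40; 71; 57; 48; 67;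
            73; 55; 62; 76];
        [:: 48; 46; 53; 19; 71; 12; 2; 0; 83; 8; 1; 23; 82; 89; 64; 27; 15; 41; 43; 37; 17; 4;
            55; 14; 3; 54; 79; 28; 16; 20; 5; 40; 52; 33; 74; 32; 65; 24; 68; 9; 47; 29; 85;
            25; 6; 31; 84; 45; 78; 81; 22; 86; 57; 44; 18; 87; 61; 35; 58; 66; 21; 88; 51; 38;
            11; 42; 70; 59; 77; 26; 67; 60; 69; 75; 49; 13; 62; 63; 7; 72; 56; 34; 30; 39; 10;
            36; 76; 50; 80; 73];
        [:: 19; 14; 40; 49; 0; 43; 61; 66; 1; 73; 76; 80; 2; 54; 8; 18; 3; 74; 47; 4; 36; 72;
            5; 77; 45; 6; 87; 30; 7; 79; 65; 84; 21; 9; 39; 10; 55; 29; 11; 75; 12; 86; 13; 22;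
            89; 51; 53; 15; 17; 16; 88; 24; 23; 68; 42; 20; 82; 50; 59; 71; 63; 25; 26; 67; 44;
            27; 28; 60; 46; 31; 56; 58; 32; 33; 48; 34; 35; 52; 81; 37; 38; 85; 70; 41; 69; 78;
            83; 62; 57; 64];
        [:: 22; 5; 88; 35; 4; 43; 72; 28; 0; 57; 32; 2; 78; 10; 1; 80; 75; 47; 52; 8; 73; 27;
            19; 33; 20; 82; 7; 42; 62; 49; 16; 50; 63; 81; 21; 70; 40; 54; 9; 53; 74; 76; 34;
            14; 66; 38; 60; 55; 24; 25; 15; 23; 69; 65; 6; 84; 30; 45; 77; 36; 41; 68; 26; 13;
            87; 83; 64; 3; 79; 85; 67; 11; 37; 48; 59; 56; 46; 12; 58; 86; 31; 51; 29; 39; 17;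
            18; 61; 44; 71; 89];
        [:: 66; 72; 21; 55; 65; 49; 7; 71; 88; 46; 48; 26; 5; 70; 73; 39; 87; 9; 25; 76; 3; 83;
            47; 12; 13; 1; 81; 11; 54; 10; 37; 80; 82; 78; 45; 24; 15; 14; 42; 34; 57; 18; 86;
            77; 30; 36; 22; 17; 43; 58; 64; 62; 60; 50; 56; 0; 69; 84; 23; 16; 38; 27; 68; 40;
            8; 2; 20; 63; 33; 79; 89; 19; 41; 44; 32; 74; 6; 29; 51; 28; 59; 61; 85; 4; 67; 75;
            52; 31; 53; 35];
        [:: 5; 0; 31; 41; 22; 1; 34; 44; 4; 2; 6; 77; 69; 3; 19; 71; 83; 85; 58; 43; 38; 53; 8;
            20; 47; 75; 7; 37; 64; 67; 29; 9; 46; 12; 10; 25; 11; 63; 23; 76; 84; 13; 16; 14;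
            26; 15; 70; 59; 81; 86; 17; 18; 55; 56; 49; 80; 21; 48; 51; 24; 65; 39; 28; 27; 62;
            79; 89; 30; 82; 33; 32; 45; 68; 40; 78; 35; 61; 36; 88; 60; 52; 57; 72; 42; 73; 50;
            54; 66; 74; 87];
        [:: 11; 24; 28; 10; 39; 54; 16; 23; 60; 21; 3; 0; 25; 59; 78; 44; 6; 35; 30; 84; 32; 9;
            87; 7; 1; 12; 86; 53; 2; 52; 18; 40; 20; 58; 68; 17; 56; 46; 74; 4; 31; 57; 88; 82;
            15; 47; 37; 45; 64; 63; 50; 79; 29; 27; 5; 55; 36; 41; 33; 13; 8; 85; 72; 49; 48;
            80; 75; 89; 34; 76; 73; 83; 62; 70; 38; 66; 69; 81; 14; 51; 65; 77; 43; 71; 19; 61;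
            26; 22; 42; 67];
        [:: 18; 30; 29; 19; 23; 50; 17; 14; 10; 22; 8; 40; 63; 26; 7; 49; 77; 6; 0; 3; 58; 43;
            9; 4; 61; 75; 13; 66; 76; 2; 1; 85; 73; 88; 51; 65; 54; 80; 67; 74; 11; 41; 71; 21;
            53; 48; 81; 52; 45; 15; 5; 34; 47; 44; 36; 62; 56; 72; 20; 87; 79; 24; 55; 12; 69;
            35; 27; 38; 84; 64; 83; 42; 57; 32; 39; 25; 28; 16; 89; 60; 37; 46; 86; 70; 68; 31;
            82; 59; 33; 78]]
    [:: [::]; [:: (7, 14)]; [:: (4, 6)]; [:: (1, 2)]; [:: (0, 1)]; [:: (0, 6)]; [:: (0, 2)]];
  UnaryRep 95
    [:: [:: 2; 5; 8; 11; 12; 14; 17; 4; 0; 23; 25; 28; 7; 32; 1; 35; 37; 40; 33; 22; 18; 45;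
            47; 50; 52; 30; 48; 24; 3; 51; 10; 60; 63; 20; 16; 67; 66; 34; 41; 36; 6; 68; 43;
            74; 58; 77; 73; 19; 64; 46; 9; 78; 27; 79; 80; 81; 44; 82; 56; 76; 65; 85; 59; 13;
            26; 31; 39; 15; 38; 71; 72; 90; 91; 49; 42; 61; 62; 21; 29; 88; 89; 94; 95; 92; 93;
            75; 83; 84; 53; 54; 69; 70; 86; 87; 55; 57];
        [:: 3; 6; 9; 0; 13; 15; 1; 19; 21; 2; 26; 29; 30; 4; 34; 5; 38; 41; 42; 7; 44; 8; 48;
            51; 53; 54; 10; 55; 57; 11; 12; 61; 64; 65; 14; 68; 69; 70; 16; 71; 72; 17; 18; 75;
            20; 78; 79; 80; 22; 81; 82; 23; 83; 24; 25; 27; 84; 28; 85; 86; 87; 31; 88; 89; 32;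
            33; 90; 91; 35; 36; 37; 39; 40; 92; 93; 43; 94; 95; 45; 46; 47; 49; 50; 52; 56; 58;
            59; 60; 62; 63; 66; 67; 73; 74; 76; 77];
        [:: 1; 4; 7; 10; 0; 8; 16; 18; 20; 22; 24; 27; 14; 31; 33; 17; 36; 39; 2; 43; 5; 32;
            46; 49; 3; 28; 38; 44; 56; 41; 58; 59; 62; 12; 35; 66; 6; 40; 61; 15; 67; 64; 23;
            73; 11; 76; 9; 50; 75; 42; 74; 48; 30; 69; 70; 71; 25; 72; 52; 13; 63; 26; 21; 77;
            29; 45; 34; 37; 78; 86; 87; 88; 89; 19; 47; 51; 65; 60; 85; 92; 93; 79; 80; 90; 91;
            68; 53; 54; 55; 57; 94; 95; 81; 82; 83; 84];
        [:: 20; 33; 1; 56; 18; 4; 67; 14; 7; 74; 58; 10; 0; 77; 8; 37; 35; 16; 5; 50; 12; 60;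
            43; 22; 44; 24; 29; 30; 27; 85; 28; 45; 31; 2; 40; 17; 15; 36; 78; 34; 39; 61; 47;
            23; 25; 32; 42; 46; 38; 19; 49; 41; 3; 55; 57; 83; 52; 84; 11; 21; 59; 51; 65; 62;
            75; 63; 6; 66; 64; 94; 95; 86; 87; 9; 73; 68; 13; 76; 48; 69; 70; 71; 72; 53; 54;
            26; 81; 82; 92; 93; 88; 89; 90; 91; 79; 80];
        [:: 31; 10; 23; 69; 16; 11; 86; 22; 17; 92; 1; 5; 45; 53; 58; 88; 4; 8; 43; 81; 32; 55;
            7; 2; 38; 91; 59; 41; 70; 62; 90; 0; 20; 35; 94; 33; 61; 95; 24; 64; 87; 27; 79;
            18; 71; 12; 75; 82; 49; 48; 93; 73; 68; 13; 63; 21; 72; 77; 14; 26; 84; 36; 29; 54;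
            39; 83; 78; 89; 52; 3; 28; 44; 56; 51; 80; 46; 85; 57; 66; 42; 74; 19; 47; 65; 60;
            76; 6; 40; 15; 67; 30; 25; 9; 50; 34; 37];
        [:: 9; 15; 21; 29; 30; 34; 41; 13; 3; 51; 54; 57; 19; 64; 6; 68; 70; 72; 65; 48; 42;
            78; 80; 82; 83; 12; 22; 53; 0; 23; 26; 87; 89; 44; 38; 91; 90; 14; 17; 69; 1; 35;
            75; 93; 85; 95; 92; 7; 32; 79; 2; 45; 55; 46; 47; 49; 20; 50; 84; 94; 33; 58; 86;
            4; 10; 61; 71; 5; 16; 39; 40; 66; 67; 81; 18; 31; 88; 8; 11; 62; 63; 76; 77; 73;
            74; 43; 52; 56; 24; 25; 36; 37; 59; 60; 27; 28];
        [:: 33; 18; 14; 58; 20; 7; 35; 5; 12; 43; 44; 30; 8; 45; 2; 16; 15; 34; 1; 23; 4; 31;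
            42; 19; 56; 27; 78; 25; 52; 61; 11; 21; 65; 0; 17; 6; 67; 39; 51; 37; 66; 75; 22;
            9; 10; 13; 74; 49; 68; 47; 73; 38; 28; 94; 95; 86; 24; 87; 3; 77; 62; 29; 60; 76;
            85; 32; 40; 36; 48; 81; 82; 92; 93; 50; 46; 41; 63; 59; 26; 90; 91; 69; 70; 88; 89;
            64; 55; 57; 83; 84; 79; 80; 71; 72; 53; 54];
        [:: 6; 13; 19; 26; 3; 21; 38; 42; 44; 48; 53; 55; 34; 61; 65; 41; 69; 71; 9; 75; 15;
            64; 79; 81; 0; 57; 16; 20; 84; 17; 85; 86; 88; 30; 68; 90; 1; 72; 31; 5; 91; 32;
            51; 92; 29; 94; 2; 82; 43; 18; 93; 22; 12; 36; 37; 39; 54; 40; 83; 4; 89; 10; 8;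
            95; 11; 78; 14; 70; 45; 59; 60; 62; 63; 7; 80; 23; 33; 87; 58; 73; 74; 46; 47; 66;
            67; 35; 24; 25; 27; 28; 76; 77; 49; 50; 52; 56];
        [:: 41; 85; 61; 37; 48; 26; 60; 78; 51; 74; 66; 36; 38; 25; 29; 63; 76; 59; 64; 50; 68;
            28; 49; 73; 17; 6; 71; 35; 15; 90; 67; 52; 24; 75; 77; 62; 32; 13; 83; 45; 21; 53;
            47; 46; 40; 27; 22; 19; 86; 23; 9; 88; 16; 5; 91; 14; 34; 70; 39; 11; 3; 79; 58;
            44; 81; 56; 31; 65; 55; 12; 54; 0; 57; 43; 42; 94; 10; 30; 92; 4; 89; 8; 95; 1; 72;
            69; 2; 82; 18; 93; 20; 84; 33; 87; 7; 80];
        [:: 12; 14; 7; 34; 33; 1; 19; 18; 4; 30; 35; 16; 20; 21; 5; 9; 43; 22; 2; 44; 0; 65;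
            58; 10; 66; 67; 55; 36; 37; 83; 15; 32; 45; 8; 42; 23; 73; 74; 71; 46; 47; 90; 3;
            11; 6; 31; 52; 56; 81; 24; 25; 92; 39; 57; 29; 84; 40; 85; 17; 62; 63; 88; 76; 77;
            94; 13; 49; 50; 69; 72; 41; 91; 68; 27; 28; 79; 59; 60; 86; 82; 51; 93; 75; 54; 26;
            53; 89; 64; 95; 78; 70; 38; 80; 48; 87; 61];
        [:: 41; 64; 48; 22; 29; 78; 17; 75; 85; 32; 46; 49; 38; 58; 61; 35; 39; 66; 51; 31; 68;
            10; 62; 76; 9; 50; 70; 42; 74; 72; 43; 52; 24; 26; 16; 36; 15; 67; 87; 34; 37; 89;
            45; 59; 23; 27; 21; 77; 93; 65; 60; 80; 19; 90; 14; 69; 47; 1; 73; 30; 25; 54; 3;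
            28; 57; 11; 6; 40; 95; 94; 33; 86; 4; 13; 63; 82; 44; 56; 84; 81; 18; 92; 7; 71; 5;
            91; 83; 12; 53; 0; 88; 8; 79; 2; 55; 20];
        [:: 13; 8; 13; 8; 4; 13; 13; 4; 8; 13; 13; 13; 8; 4; 13; 8; 65; 13; 8; 65; 13; 13; 13;
            8; 13; 65; 13; 8; 13; 8; 13; 13; 8; 4; 13; 13; 13; 13; 4; 13; 65; 13; 13; 4; 13;
            13; 65; 13; 8; 13; 13; 13; 4; 8; 4; 13; 13; 13; 65; 65; 13; 8; 13; 13; 13; 65; 8;
            4; 8; 13; 8; 8; 4; 13; 8; 4; 13; 8; 13; 4; 13; 13; 8; 4; 8; 4; 4; 13; 13; 8; 13; 4;
            8; 13; 8; 13]]
    [:: [::]; [:: (4, 13)]; [:: (11, 21)]; [:: (1, 5)]; [:: (1, 3)]; [:: (2, 4)]; [:: (0, 1)]]].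

(** * The two finite computations and the theorem *)

Lemma catalog_ok : all check_rep catalog.
Proof. by vm_compute. Qed.

(** Up to isomorphism there are 1, 1, 1, 2, 5, 15 and 53 lattices with 1 to 7 elements. The catalog
    has one entry for each of them except [L7], hence 52 entries of size 7. *)
Lemma catalog_covers : all (covers catalog) (iota 1 7).
Proof. by vm_compute. Qed.

Theorem theorem6p1p1 (d : Order.disp_t) (L : finLatticeType d) :
  (0 < #|L| <= 7)%N ->
  ~ lattice_isomorphic L L7 ->
  exists A : finAlgebra, lattice_isomorphic L (Con A).
Proof.
move=> /andP[n_gt0 n_le7] not_L7.
have /card_gt0P[x0 _] := n_gt0.
have L_covered : covers catalog #|L|.
  by apply: (allP catalog_covers); rewrite mem_iota n_gt0 ltnS.
by case: (rep_of_covers x0 catalog_ok L_covered).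
Qed.
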